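(* The generating function $F=F(s,u,v,p_1,p_2,\dots)$ of the numbers $N_{k,l}(\mu)$ of dessins d'enfants satisfies the infinite system of equations of the KP (Kadomtsev–Petviashvili) hierarchy with respect to the variables $p_1,p_2,\dots$, for any parameters $s,u,v$. Equivalently, $Z=e^F$ is a 3-parameter family (with parameters $s,u,v$) of KP tau functions.
   Context: A Belyi pair $(C,f)$ is a smooth compact connected complex algebraic curve $C$ together with a non-constant meromorphic function $f:C\to\mathbb{C}P^1$ unramified over $\mathbb{C}P^1\setminus\{0,1,\infty\}$. For positive integers $k,l,m$ and $\mu=(\mu_1,\dots,\mu_m)\in\mathbb{Z}_{>0}^m$, let $\mathcal{D}_{k,l;\mu}$ be the set of isomorphism classes of Belyi pairs with $|f^{-1}(0)|=k$, $|f^{-1}(1)|=l$ (numbers of distinct points), whose $m$ poles are labeled $1,\dots,m$, the $i$-th pole having order $\mu_i$. Isomorphisms are isomorphisms of curves commuting with the maps $f$ and preserving the labels of the poles. (Equivalently, these are connected bicolored ribbon graphs (dessins) $\Gamma=f^{-1}([0,1])$ with $k$ white vertices, $l$ black vertices, $d=\sum_i\mu_i$ edges and $m$ labeled boundary components.) Put $$N_{k,l}(\mu)=\sum_{\Gamma\in\mathcal{D}_{k,l;\mu}}\frac1{|\mathrm{Aut}_b\Gamma|},$$ where $\mathrm{Aut}_b\Gamma$ is the (finite) group of automorphisms preserving each boundary component (i.e. each pole). The generating function is $$F(s,u,v,p_1,p_2,\dots)=\sum_{k,l,m\ge1}\frac1{m!}\sum_{\mu\in\mathbb{Z}_{>0}^m}N_{k,l}(\mu)\,s^{d}u^kv^l\,p_{\mu_1}\cdots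 p_{\mu_m},\qquad d=\sum_{i=1}^m\mu_i,$$ an element of $\mathbb{Q}[u,v,p_1,p_2,\dots][[s]]$; $s,u,v$ are treated as formal parameters. KP hierarchy: the variables $p_k$ are related to the standard KP times $t_k$ by $t_k=p_k/k$. A series $Z=Z(p_1,p_2,\dots)$ is a KP tau function, and $F=\log Z$ a solution of the KP hierarchy, if the Hirota bilinear identity holds: for two independent sets of variables $p=(p_k)$, $p'=(p'_k)$, the coefficient of $\zeta^{-1}$ in $$\exp\Bigl(\sum_{k\ge1}\frac{(p_k-p'_k)\zeta^k}{k}\Bigr)\,Z\bigl(p_1-\zeta^{-1},p_2-\zeta^{-2},\dots\bigr)\,Z\bigl(p'_1+\zeta^{-1},p'_2+\zeta^{-2},\dots\bigr)$$ vanishes. With this normalization the first equation of the hierarchy is $F_{22}=-\frac12F_{11}^2+F_{31}-\frac1{12}F_{1111}$ and the second is $F_{32}=-F_{11}F_{21}+F_{41}-\frac16F_{2111}$, where the subscript $i$ denotes $\partial/\partial p_i$. *)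

(* Defs.v *)
From HB Require Import structures.
From mathcomp Require Import all_boot all_order all_fingroup all_algebra.
From mathcomp Require Import finmap monalg.

Set Implicit Arguments.
Unset Strict Implicit.
Unset Printing Implicit Defensive.

Import GRing.Theory Num.Theory.

Local Open Scope ring_scope.

(* A Belyi pair (C, f) of degree d is represented by its dessin f^{-1}([0, 1]),
   a bicolored ribbon graph, here with edges 'I_d: the cycles of [white] (resp.
   [black]) are the white (resp. black) vertices, each cycle listing the edges
   at that vertex in counterclockwise order.  Travelling along an edge from its
   black to its white end, then along the next edge back to a black vertex, and
   so on, one sees that the boundary components are the cycles of the product of
   the two permutations, a cycle of length n being a boundary component with 2n
   sides, i.e. a pole of order n of the Belyi function.  [label] gives, for each
   edge, the label of the boundary component that has this edge, taken from
   black to white, on its boundary. *)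
Record ribbon (d m : nat) := Ribbon {
  white : 'S_d;
  black : 'S_d;
  label : {ffun 'I_d -> 'I_m}
}.

Definition ribbon_prod d m (G : ribbon d m) := (white G, black G, label G).
Definition prod_ribbon d m (x : 'S_d * 'S_d * {ffun 'I_d -> 'I_m}) :=
  Ribbon x.1.1 x.1.2 x.2.
Lemma ribbon_prodK d m : cancel (@ribbon_prod d m) (@prod_ribbon d m).
Proof. by case. Qed.
HB.instance Definition _ d m :=
  Finite.copy (ribbon d m) (can_type (@ribbon_prodK d m)).

Section Ribbon.
Variables d m : nat.
Implicit Types G H : ribbon d m.

Definition adjacent_edges G : rel 'I_d :=
  [rel e e' | (e' \in porbit (white G) e) || (e' \in porbit (black G) e)].

Definition connected G :=
  [forall e, forall e', connect (adjacent_edges G) e e'].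

(* Two edges have the same label exactly when they determine the same boundary
   component, and the i-th boundary component has length mu i. *)
Definition labeled_by (mu : 'I_m -> nat) G :=
  [forall e, forall e',
     (label G e == label G e') == (e' \in porbit (white G * black G)%g e)]
  && [forall i, #|[set e | label G e == i]| == mu i].

Definition relabel (g : 'S_d) G : ribbon d m :=
  Ribbon (white G ^ g)%g (black G ^ g)%g [ffun e => label G ((g^-1)%g e)].

Definition isomorphic : rel (ribbon d m) :=
  [rel G H | [exists g : 'S_d, relabel g G == H]].

Lemma isomorphic_equivalence : equivalence_rel isomorphic.
Proof.
have relabelM g h G : relabel h (relabel g G) = relabel (g * h)%g G.
  rewrite /relabel /= !conjgM; congr Ribbon.
  by apply/ffunP => e; rewrite !ffunE invMg permM.
have relabel1 G : relabel 1%g G = G.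
  case: G => w b f; rewrite /relabel /= !conjg1; congr Ribbon.
  by apply/ffunP => e; rewrite ffunE invg1 perm1.
move=> G H K; split=> [|/existsP[g /eqP <-]].
  by apply/existsP; exists 1%g; rewrite relabel1.
apply/existsP/existsP => -[h /eqP <-].
  by exists (g^-1 * h)%g; rewrite relabelM mulKVg.
by exists (g * h)%g; rewrite relabelM.
Qed.

Definition Aut_b G : {set 'S_d} := [set g | relabel g G == G].

End Ribbon.

Section Count.
Variables (m k l : nat) (mu : 'I_m -> nat).

Definition dessins : {set ribbon (\sum_i mu i)%N m} :=
  [set G | [&& connected G, #|porbits (white G)| == k,
               #|porbits (black G)| == l & labeled_by mu G]].

Definition dessin_classes := equivalence_partition (@isomorphic _ _) dessins.

(* The sum over isomorphism classes, one representative being chosen in each. *)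
Definition dessin_count : rat :=
  \sum_(G in transversal dessin_classes dessins) (#|Aut_b G|%:R)^-1.

End Count.

Definition series_mul (R : pzRingType) (f g : nat -> R) : nat -> R :=
  fun n => \sum_(i < n.+1) f i * g (n - i)%N.

Definition series_one (R : pzRingType) : nat -> R := fun n => (n == 0%N)%:R.

Definition series_pow (R : pzRingType) (f : nat -> R) (n : nat) : nat -> R :=
  iter n (series_mul f) (@series_one R).

(* exp f = sum_i f^i / i! for a series f without constant term: f^i then has no
   terms of degree < i, so the sum stops at i = n in degree n. *)
Definition series_exp (R : algType rat) (f : nat -> R) : nat -> R :=
  fun n => \sum_(i < n.+1) (i`!%:R^-1 : rat) *: series_pow f i n.

Notation mpolyQ I := {malg rat[{cmonom I}]}.

Definition mvar (I : choiceType) (i : I) : mpolyQ I := << ucm i >>.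

Definition msubst (I J : choiceType) (x : I -> {poly (mpolyQ J)})
    (f : mpolyQ I) : {poly (mpolyQ J)} :=
  mmap (fun a : rat => (a%:MP)%:P)
       (fun c : {cmonom I} =>
          \prod_(i <- finsupp (cmonom_val c)) x i ^+ c i) f.

(* T indexes formal parameters on which the tau function may depend besides the
   expansion variable s.  The variable [inr i] stands for p_{i+1}; in the ring
   where the bilinear identity lives, [inr (inl i)] and [inr (inr i)] stand for
   p_{i+1} and p'_{i+1}. *)
Section KP.
Variable T : choiceType.

Definition one_set := (T + nat)%type.
Definition two_sets := (T + (nat + nat))%type.

(* The polynomial variable 'X is zeta^{-1}. *)
Definition minus_shift (x : one_set) : {poly (mpolyQ two_sets)} :=
  match x with
  | inl t => (mvar (inl t : two_sets))%:P
  | inr i => (mvar (inr (inl i) : two_sets))%:P - 'X^(i.+1)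
  end.

Definition plus_shift (x : one_set) : {poly (mpolyQ two_sets)} :=
  match x with
  | inl t => (mvar (inl t : two_sets))%:P
  | inr i => (mvar (inr (inr i) : two_sets))%:P + 'X^(i.+1)
  end.

(* The series sum_{k >= 1} (p_k - p'_k) zeta^k / k. *)
Definition hirota_exponent (k : nat) : mpolyQ two_sets :=
  if k is i.+1 then
    (i.+1%:R^-1 : rat) *:
      (mvar (inr (inl i) : two_sets) - mvar (inr (inr i) : two_sets))
  else 0.

(* Coefficient of zeta^{-1} in e(zeta) * g(zeta^{-1}), for a series e and a
   polynomial g. *)
Definition residue (R : nzRingType) (e : nat -> R) (g : {poly R}) : R :=
  \sum_(j < size g) e j * g`_j.+1.

(* Z is a power series in s, given by its coefficients; the coefficient of each
   s^n in the bilinear identity is a series in zeta times a polynomial in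
   zeta^{-1}. *)
Definition KP_tau (Z : nat -> mpolyQ one_set) : Prop :=
  forall n : nat,
    residue (series_exp hirota_exponent)
      (series_mul (fun a => msubst minus_shift (Z a))
                  (fun b => msubst plus_shift (Z b)) n) = 0.

Definition KP_solution (F : nat -> mpolyQ one_set) : Prop :=
  KP_tau (series_exp F).

End KP.

(* The two parameters: u is indexed by false, v by true. *)
Definition dessin_ring := mpolyQ (one_set bool).
Definition u_var : dessin_ring := mvar (inl false : one_set bool).
Definition v_var : dessin_ring := mvar (inl true : one_set bool).

(* p_n, for n >= 1 *)
Definition p_var (n : nat) : dessin_ring := mvar (inr n.-1 : one_set bool).

(* A dessin has at most as many vertices of each color as it has edges; hence
   the bounds on k and l in the generating function lose nothing. *)
Lemma dessin_count_eq0 m k l (mu : 'I_m -> nat) :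
  (\sum_i mu i < maxn k l)%N -> dessin_count k l mu = 0.
Proof.
move=> lt_d; suff d0 : dessins k l mu = set0.
  by rewrite /dessin_count /transversal d0 imset0 big_set0.
have le_porbits (s : 'S_(\sum_i mu i)) : (#|porbits s| <= \sum_i mu i)%N.
  by rewrite -[leqRHS]card_ord leq_imset_card.
apply/setP => G; rewrite !inE; apply/negP => /and4P[_ /eqP k_eq /eqP l_eq _].
by move: lt_d; rewrite ltnNge geq_max -k_eq -l_eq !le_porbits.
Qed.

(* The coefficient of s^d; all of k, l, m and the mu_i are at most d there. *)
Definition dessin_gf (d : nat) : dessin_ring :=
  \sum_(1 <= k < d.+1) \sum_(1 <= l < d.+1) \sum_(1 <= m < d.+1)
    (m`!%:R^-1 : rat) *:
    \sum_(mu : {ffun 'I_m -> 'I_d.+1} |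
           [forall i, (0 < mu i)%N] && (\sum_i mu i == d)%N)
      dessin_count k l (fun i => mu i : nat) *:
        (u_var ^+ k * v_var ^+ l * \prod_i p_var (mu i)).

(* Main.v *)
(* Write Z_n = (1/n!) sum_(w, b in S_n) u^c(w) v^c(b) p_(cycle type of w b), where
   c counts cycles.  By orbit counting and the exponential formula, sum_n Z_n s^n
   is the exponential of the generating function of dessins.

   Let K be the cut-and-join operator: it maps the cycle type p_s of a permutation
   s to the sum of those of s t over all transpositions t.  Each element of
   S_n+1 is uniquely s or s t_i, with s in S_n and t_i = (i, n+1), and sum_i t_i is
   the difference of the sums of all transpositions of S_n+1 and of S_n; hence

     (n+1) Z_n+1 = (u v p_1 + (u+v) [K, p_1] + [K, [K, p_1]]) Z_n.

   The bilinear form B(f, g) whose vanishing on (Z, Z) is the Hirota identity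
   intertwines K (x) 1 + 1 (x) K, as well as p_1 (x) 1 + 1 (x) p_1, with operators on
   the target; hence it also intertwines their commutators, and the coefficients
   B_n of B(Z, Z) satisfy a linear recursion in which B_n+1 is the image of B_n
   by an operator.  As B_0 = B(1, 1) = 0, all of them vanish. *)

From HB Require Import structures.
From mathcomp Require Import all_boot all_order all_fingroup all_algebra.
From mathcomp Require Import finmap monalg ring zify.
Require Import Defs.

Set Implicit Arguments.
Unset Strict Implicit.
Unset Printing Implicit Defensive.

Import GRing.Theory Num.Theory.

Local Open Scope ring_scope.

(** * Substitutions and partial derivatives *)

(** Why the target operator for K exists. Put z = zeta^-1. The exponential in the p_k times f(p_k -
    z^k) is a vertex operator applied to f. Commuting the cut-and-join operator past it leaves,
    besides twice the Euler field, the operator theta - theta^2 with theta = z d/dz. The other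
    factor is the dual vertex operator; it yields the same expression with the two factors exchanged
    and the opposite sign. What remains in the sum of both is a total derivative, and the residue
    kills it.

    The operators are infinite sums over the variables, but each polynomial involves finitely many
    of them; hence every sum is truncated at a bound that depends on the argument.

    The sums run over ordered pairs, so the formal operator is 2K. The recursion for Z_n is
    therefore used in the form multiplied by 4, with coefficients 4uv and 2(u+v), which avoids
    halves.

    No logarithm of Z is taken: both exp F and the sums over pairs of permutations satisfy n Z_n =
    sum_j j F_j Z_(n-j). *)

Lemma coef1M (R : nzSemiRingType) (p q : {poly R}) :
  (p * q)`_1 = p`_1 * q`_0 + p`_0 * q`_1.
Proof. by rewrite coefM !big_ord_recl big_ord0 addr0 addrC. Qed.

Definition Leibniz (R : nzRingType) (d : R -> R) :=
  forall f g, d (f * g) = d f * g + f * d g.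

Lemma derivation_alg (R : comAlgType rat) (d : {linear R -> R}) (a : rat) :
  Leibniz d -> d a%:A = 0.
Proof.
move=> dM; have d1 : d 1 = 0.
  by apply: (@addrI _ (d 1)); rewrite addr0 -{3}[1]mulr1 dM mulr1 mul1r.
by rewrite linearZ /= d1 scaler0.
Qed.

(** The commutator of two derivations is a derivation, so it vanishes once it does on the generators
    [x i]. The first hypothesis is induction on polynomials. *)
Lemma derivation_comm (R : comAlgType rat) (I : Type) (x : I -> R)
    (d e : {linear R -> R}) :
    (forall P : R -> Prop,
       (forall a : rat, P a%:A) -> (forall f g, P f -> P g -> P (f + g)) ->
       (forall i f, P f -> P (x i * f)) -> forall f, P f) ->
    Leibniz d -> Leibniz e -> (forall i, d (e (x i)) = e (d (x i))) ->
  forall f, d (e f) = e (d f).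
Proof.
move=> R_ind dM eM dex f; elim/R_ind: f => [a|f g IHf IHg|i f IHf].
- by rewrite !derivation_alg // !linear0.
- by rewrite !linearD /= IHf IHg.
by rewrite dM eM !linearD /= !dM !eM IHf dex addrACA.
Qed.

Section PolynomialRing.
Variable I : choiceType.

(** Reduces identities between substitutions or derivations to constants and variables. A monomial
    is built one variable at a time, by induction on its degree. *)
Lemma mpoly_ind (P : mpolyQ I -> Prop) :
    (forall a : rat, P a%:MP) ->
    (forall f g, P f -> P g -> P (f + g)) ->
    (forall i f, P f -> P (mvar i * f)) ->
  forall f, P f.
Proof.
move=> PC PD PX f; rewrite (monalgE f).
elim/big_rec: _ => [|c g _ Pg]; first by rewrite -malgC0E; apply: PC.
apply: PD => //; move: (f@_c) => a {f g Pg}.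
have [n] := ubnP (mdeg c); elim: n => // n IHn in c *; rewrite ltnS => lt_c.
have [/eqP/mdeg_eq0I ->|] := boolP (mdeg c == 0%N); first exact: PC.
rewrite mdeg_eq0 => c1.
have [i ci] : exists i, i \in finsupp c.
  apply/fset0Pn; apply: contraNneq c1 => c0; apply/eqP/eqP/cmP => i.
  by rewrite cm1; apply/eqP; rewrite cmE_eq0 c0.
have def_c : c = mmul (ucm i) (divcm c (ucm i)).
  apply/eqP/cmP => j; rewrite cmM divcmE cmU.
  by case: eqP => [<-|_]; rewrite ?subn0 // subnKC // lt0n cmE_neq0.
have -> : << a *g c >> = mvar i * << a *g divcm c (ucm i) >>.
  by rewrite {1}def_c malgM_def fgmulUU mul1r.
apply: PX; apply: IHn; move: lt_c; rewrite {1}def_c mdegM mdegU.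
by apply: leq_trans.
Qed.

End PolynomialRing.

(* Locked, since unfolding [msubst] makes failed conversion tests diverge. *)
HB.lock Definition mcompose (I J : choiceType) (x : I -> {poly (mpolyQ J)})
  (f : mpolyQ I) : {poly (mpolyQ J)} := msubst x f.

Section Substitution.
Variables (I J : choiceType) (x : I -> {poly (mpolyQ J)}).

Let ev (c : {cmonom I}) := \prod_(i <- finsupp (cmonom_val c)) x i ^+ c i.

Let evE (D : {fset I}) (c : {cmonom I}) : (finsupp c `<=` D)%fset ->
  ev c = \prod_(i <- D) x i ^+ c i.
Proof.
move=> le_D; rewrite /ev; apply/esym.
rewrite (big_fsetID _ (fun i => i \in finsupp c)) /= [X in _ * X]big1_fset ?mulr1.
  by apply: eq_fbigl => i; rewrite !inE /= andb_idl // => /(fsubsetP le_D).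
move=> i; rewrite !inE /= => /andP[_]; rewrite -cmE_eq0 => /eqP -> _.
by rewrite expr0.
Qed.

Let ev_morphism : mmorphism ev.
Proof.
split=> [c d|].
  rewrite !(@evE (finsupp c `|` finsupp d)%fset) ?fsubsetUl ?fsubsetUr //; last first.
    by rewrite mdomD.
  by rewrite -big_split; apply: eq_bigr => i _; rewrite cmM exprD.
by rewrite /ev (_ : finsupp _ = fset0) ?big_seq_fset0 //; apply: mdom1.
Qed.

HB.instance Definition _ := isMultiplicative.Build _ _ ev ev_morphism.

Let mcompose_nmod : nmod_morphism (mcompose x).
Proof.
rewrite mcompose.unlock; split; first exact: raddf0 (mmap (polyC \o malgC) ev).
exact: raddfD (mmap (polyC \o malgC) ev).
Qed.

Let mcompose_monoid : monoid_morphism (mcompose x).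
Proof.
rewrite mcompose.unlock; split; first exact: rmorph1 (mmap (polyC \o malgC) ev).
exact: rmorphM (mmap (polyC \o malgC) ev).
Qed.

HB.instance Definition _ :=
  GRing.isNmodMorphism.Build _ _ (mcompose x) mcompose_nmod.
HB.instance Definition _ :=
  GRing.isMonoidMorphism.Build _ _ (mcompose x) mcompose_monoid.

Let mcomposeU (a : rat) (c : {cmonom I}) :
  mcompose x << a *g c >> = (a%:MP)%:P * ev c.
Proof. rewrite mcompose.unlock; exact: (mmapU (f := polyC \o malgC)). Qed.

Lemma mcomposeC (a : rat) : mcompose x a%:MP = (a%:MP)%:P.
Proof. by rewrite mcomposeU mmorph1 mulr1. Qed.

Lemma mcomposeX i : mcompose x (mvar i) = x i.
Proof.
rewrite mcomposeU mul1r /ev (_ : finsupp _ = [fset i]%fset); last exact: mdomU.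
by rewrite big_seq_fset1 cmUU expr1.
Qed.

Lemma mcomposeZ (a : rat) (f : mpolyQ I) :
  mcompose x (a *: f) = (a%:MP)%:P * mcompose x f.
Proof. by rewrite -mul_malgC rmorphM /= mcomposeC. Qed.

End Substitution.

Lemma eq_mcompose (I J : choiceType) (x y : I -> {poly (mpolyQ J)}) f :
    (forall c i, c \in msupp f -> i \in finsupp (cmonom_val c) -> x i = y i) ->
  mcompose x f = mcompose y f.
Proof.
move=> eq_xy; rewrite mcompose.unlock /msubst !mmapE.
apply: eq_big_seq => c f_c; congr (_ * _); apply: eq_big_seq => i c_i.
by rewrite (eq_xy c).
Qed.

Lemma mcompose_mvar (I : choiceType) (f : mpolyQ I) :
  mcompose (fun i => (mvar i)%:P) f = f%:P.
Proof.
elim/mpoly_ind: f => [a|f g IHf IHg|i f IHf]; first exact: mcomposeC.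
  by rewrite rmorphD polyCD /= IHf IHg.
by rewrite rmorphM polyCM /= mcomposeX IHf.
Qed.

(* The derivative is read off the first-order term of a substitution
   [x_i + epsilon], so that linearity and the Leibniz rule are inherited from
   [mcompose]. *)
Definition shift_var (I : choiceType) (i j : I) : {poly (mpolyQ I)} :=
  (mvar j)%:P + ((i == j)%:R)%:P * 'X.

HB.lock Definition pderiv (I : choiceType) (i : I) (f : mpolyQ I) : mpolyQ I :=
  (mcompose (shift_var i) f)`_1.

Section PartialDerivatives.
Variable I : choiceType.
Implicit Types (i j : I) (f g : mpolyQ I).

Lemma pderiv_is_linear i : linear (pderiv i).
Proof.
move=> a f g; rewrite pderiv.unlock rmorphD /= mcomposeZ coefD coefCM.
by rewrite mul_malgC.
Qed.

HB.instance Definition _ i :=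
  GRing.isLinear.Build rat (mpolyQ I) (mpolyQ I) _ (pderiv i) (pderiv_is_linear i).

Lemma mcompose_shift0 i f : (mcompose (shift_var i) f)`_0 = f.
Proof.
elim/mpoly_ind: f => [a|f g IHf IHg|j f IHf].
- by rewrite mcomposeC coefC.
- by rewrite rmorphD coefD /= IHf IHg.
rewrite rmorphM coef0M /= mcomposeX IHf; congr (_ * _).
by rewrite /shift_var coefD coefC coefMX addr0.
Qed.

Lemma pderivC i (a : rat) : pderiv i a%:MP = 0.
Proof. by rewrite pderiv.unlock mcomposeC coefC. Qed.

Lemma pderiv_natr i n : pderiv i n%:R = 0.
Proof. by rewrite -mpolyC_nat pderivC. Qed.

Lemma pderivX i j : pderiv i (mvar j) = (i == j)%:R.
Proof.
by rewrite pderiv.unlock mcomposeX coefD coefC coefCM coefX mulr1 add0r.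
Qed.

Lemma pderivD i f g : pderiv i (f + g) = pderiv i f + pderiv i g.
Proof. exact: raddfD. Qed.

Lemma pderivM i f g : pderiv i (f * g) = pderiv i f * g + f * pderiv i g.
Proof.
by rewrite pderiv.unlock rmorphM coef1M /= !mcompose_shift0.
Qed.

Lemma pderiv_comm i j f : pderiv i (pderiv j f) = pderiv j (pderiv i f).
Proof.
apply: (derivation_comm (x := @mvar I)) f => [P PC|f g|f g|k].
- by apply: mpoly_ind => a; rewrite -[a%:MP]mulr1 mul_malgC.
- exact: pderivM.
- exact: pderivM.
by rewrite /= !pderivX !pderiv_natr.
Qed.

(** With [index] the rank k of a variable p_k and 0 on all other variables, the derivatives of [f]
    with respect to p_k vanish from this bound on, so that sums over k can be cut there. *)
Definition var_bound (index : I -> nat) f : nat :=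
  \max_(c <- msupp f) \max_(i <- finsupp (cmonom_val c)) (index i).+1.

Lemma pderiv_eq0 (index : I -> nat) i f :
  (var_bound index f <= index i)%N -> pderiv i f = 0.
Proof.
move=> le_i; rewrite pderiv.unlock (@eq_mcompose _ _ _ (fun j => (mvar j)%:P)).
  by rewrite mcompose_mvar coefC.
move=> c j f_c c_j; rewrite /shift_var; case: eqP => [ij|_]; last first.
  by rewrite mul0r addr0.
have /leq_trans/(_ le_i) : ((index i).+1 <= var_bound index f)%N; last first.
  by rewrite ltnn.
rewrite /var_bound (big_rem c) //= (big_rem j) //= -ij.
by rewrite -maxnA leq_maxl.
Qed.

End PartialDerivatives.

(** * Vertex operators and the cut-and-join operator *)

Section Sums.
Variable V : nmodType.

Lemma sum_shift (g : nat -> V) M i :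
    (forall l, (M <= l)%N -> g l = 0) ->
  \sum_(l < M | (i <= l)%N) g l = \sum_(j < M) g (i + j)%N.
Proof.
elim: M g i => [|M IH] g i g0; first by rewrite !big_ord0.
case: i => [|i]; first exact: eq_bigl.
rewrite big_mkcond big_ord_recl /= add0r -big_mkcond /=.
rewrite (IH (fun l => g l.+1)) => [|l leMl]; last exact: g0.
by rewrite big_ord_recr /= [g (_ + M)%N]g0 ?addr0 // addSn ltnS leq_addl.
Qed.

Lemma sum_triangle (g : nat -> nat -> V) M :
    (forall i j, (M <= i + j)%N -> g i j = 0) ->
  \sum_(i < M) \sum_(j < M) g i j = \sum_(n < M) \sum_(i < n.+1) g i (n - i)%N.
Proof.
move=> g0; transitivity (\sum_(i < M) \sum_(n < M | (i <= n)%N) g i (n - i)%N).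
  apply: eq_bigr => i _; rewrite (@sum_shift (fun n => g i (n - i)%N)).
    by apply: eq_bigr => j _; rewrite addKn.
  by move=> l leMl; apply: g0; apply: leq_trans leMl _; rewrite -leq_subLR.
rewrite (exchange_big_dep xpredT) //=; apply: eq_bigr => n _.
by rewrite (big_ord_widen M (fun i => g i (n - i)%N)).
Qed.

Lemma sum_trichotomy (g : nat -> nat -> V) M :
    (forall k l, (M <= k)%N || (M <= l)%N -> g k l = 0) ->
  \sum_(k < M) \sum_(l < M) g k l =
    \sum_(k < M) g k k
    + \sum_(i < M) \sum_(j < M | (0 < j)%N) g i (i + j)%N
    + \sum_(i < M) \sum_(j < M | (0 < j)%N) g (i + j)%N i.
Proof.
move=> g0.
have shift (h : nat -> V) (i : 'I_M) : (forall l, (M <= l)%N -> h l = 0) ->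
    \sum_(l < M | (i < l)%N) h l = \sum_(j < M | (0 < j)%N) h (i + j)%N.
  move=> h0; rewrite (@sum_shift h M i.+1) //.
  case: M {g0} i h0 => [|M] i h0; first by case: i.
  rewrite big_ord_recr /= h0 ?addr0; last by rewrite addSn ltnS leq_addl.
  rewrite [RHS]big_mkcond big_ord_recl /= add0r.
  by apply: eq_bigr => j _; rewrite addSnnS.
rewrite -addrA [X in _ = X]addrCA.
transitivity (\sum_(k < M) (\sum_(l < M | (k < l)%N) g k l
   + (g k k + \sum_(l < M | (l < k)%N) g k l))).
  apply: eq_bigr => k _; rewrite (bigID (fun l : 'I_M => (k < l)%N)) /=.
  congr (_ + _); rewrite (bigD1 k) ?ltnn //=; congr (_ + _).
  by apply: eq_bigl => l; rewrite -leqNgt ltn_neqAle andbC.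
rewrite !big_split /=; congr (_ + (_ + _)).
  by apply: eq_bigr => i _; apply: shift => l leMl; rewrite g0 ?leMl ?orbT.
rewrite (exchange_big_dep xpredT) //=; apply: eq_bigr => i _.
by apply: (shift (g^~ i)) => l leMl; rewrite g0 ?leMl.
Qed.

End Sums.

(** A positive [n] is a sum of two positive integers in [n - 1] ordered ways. *)
Lemma sum_triangle_pos (R : pzRingType) (g : nat -> R) M :
    (forall n, (M <= n)%N -> g n = 0) ->
  \sum_(i < M) \sum_(j < M) (if (0 < i)%N && (0 < j)%N then g (i + j)%N else 0)
  = \sum_(n < M) n%:R * g n - \sum_(n < M | (0 < n)%N) g n.
Proof.
move=> g0.
rewrite (@sum_triangle _ (fun i j => if (0 < i)%N && (0 < j)%N then g (i + j)%N else 0)); last first.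
  by move=> i j /g0 ->; case: ifP.
rewrite [X in _ - X]big_mkcond -sumrB; apply: eq_bigr => -[[|n] ltnM] _ /=.
  by rewrite big_ord1 mul0r subr0.
rewrite big_ord_recl big_ord_recr /= subnn ltnn add0r addr0.
rewrite (eq_bigr (fun=> g n.+1)) => [|i _]; last first.
  by rewrite /= /bump /= add1n subSS subn_gt0 ltn_ord /= addSn subnKC // ltnW.
by rewrite sumr_const card_ord mulr_natl mulrS addrAC subrr add0r.
Qed.

(* The coefficient of z^m in e(1/z) X(z). *)
HB.lock Definition bracket (A : comNzRingType) (e : nat -> A) (m : nat)
    (X : {poly A}) : A :=
  \sum_(a < size X) X`_a * (if (m <= a)%N then e (a - m)%N else 0).

Section Bracket.
Variables (A : comNzRingType) (e : nat -> A).
Implicit Types X Y : {poly A}.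

Let ee m a : A := if (m <= a)%N then e (a - m) else 0.

Local Notation bracket := (bracket e).

Lemma bracketE N m X : (size X <= N)%N ->
  bracket m X = \sum_(a < N) X`_a * ee m a.
Proof.
move=> leN; rewrite bracket.unlock (big_ord_widen N (fun a => X`_a * ee m a)) //.
rewrite big_mkcond; apply: eq_bigr => a _; case: ltnP => // leXa.
by rewrite nth_default ?mul0r.
Qed.

Lemma bracket_is_linear m : linear_for *%R (bracket m).
Proof.
move=> c X Y; pose N := maxn (size (c *: X + Y)) (maxn (size X) (size Y)).
rewrite !(@bracketE N) ?leq_max ?leqnn ?orbT // mulr_sumr -big_split.
by apply: eq_bigr => a _; rewrite coefD coefZ mulrDl mulrA.
Qed.

HB.instance Definition _ m :=
  GRing.isLinear.Build A {poly A} A *%R (bracket m) (bracket_is_linear m).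

Lemma bracketZ m c X : bracket m (c *: X) = c * bracket m X.
Proof. exact: linearZ. Qed.

Lemma bracketXn m j X : bracket (m + j) ('X^j * X) = bracket m X.
Proof.
rewrite (@bracketE (j + size X)) ?big_split_ord /=; last first.
  by rewrite (leq_trans (size_polyMleq _ _)) // size_polyXn.
rewrite big1 => [|a _]; last by rewrite coefXnM ltn_ord mul0r.
rewrite add0r (bracketE _ (leqnn (size X))); apply: eq_bigr => a _.
by rewrite coefXnM ltnNge leq_addr addKn /ee addnC leq_add2l subnDl.
Qed.

Lemma bracket_eq0 m X : (size X <= m)%N -> bracket m X = 0.
Proof.
move=> le_m; rewrite bracket.unlock big1 // => a _; rewrite /ee leqNgt.
by rewrite (leq_trans (ltn_ord a)) // mulr0.
Qed.

End Bracket.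

Definition theta (A : nzRingType) (X : {poly A}) : {poly A} := 'X * X^`().

Lemma size_theta (A : nzRingType) (X : {poly A}) : (size (theta X) <= size X)%N.
Proof.
have [->|X0] := eqVneq X 0; first by rewrite /theta deriv0 mulr0 size_poly0.
rewrite /theta (leq_trans (size_polyMleq _ _)) // size_polyX /=.
exact: lt_size_deriv.
Qed.

(** The recursion for [e] says that theta e(1/z) = - q(1/z) e(1/z). Hence e theta X = theta (e X) +
    q e X, and theta multiplies the coefficient of z^m by m. *)
Lemma bracket_theta (A : comNzRingType) (e q : nat -> A) M m (X : {poly A}) :
    q 0%N = 0 ->
    (forall j, j%:R * e j = \sum_(k < j.+1) q k * e (j - k)%N) ->
    (size X <= M)%N ->
  bracket e m (theta X)
  = m%:R * bracket e m X + \sum_(k < M) q k * bracket e (m + k) X.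
Proof.
move=> q0 e_rec leM.
have le_th : (size (theta X) <= M)%N := leq_trans (size_theta X) leM.
rewrite !(bracketE _ _ le_th, bracketE _ _ leM) mulr_sumr.
under [X in _ + X]eq_bigr => k _ do rewrite (bracketE _ _ leM) mulr_sumr.
rewrite exchange_big -big_split /=; apply: eq_bigr => a _.
under [X in _ + X]eq_bigr => k _ do rewrite mulrCA.
rewrite -mulr_sumr mulrCA -mulrDr /theta coefXM coef_deriv.
have -> : (if a == 0%N :> nat then 0 else X`_a.-1.+1 *+ a.-1.+1) = X`_a *+ a.
  by case: (nat_of_ord a).
rewrite mulrnAl -mulrnAr -mulr_natl; congr (_ * _).
case: (leqP m a) => [le_ma|lt_am]; last first.
  rewrite !mulr0 add0r big1 // => k _; rewrite leqNgt.
  by rewrite (leq_trans lt_am) ?leq_addr ?mulr0.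
rewrite -{1}(subnKC le_ma) natrD mulrDl e_rec; congr (_ + _).
rewrite (big_ord_widen M (fun k => q k * e (a - m - k)%N)); last first.
  by rewrite (leq_ltn_trans (leq_subr _ _)).
rewrite big_mkcond; apply: eq_bigr => k _.
by rewrite ltnS leq_subRL // subnDA; case: ifP; rewrite ?mulr0.
Qed.

(** The sums start at 0 because [p 0] and [d 0] vanish where this is used. They run over ordered
    pairs, so each pair of distinct indices occurs twice. *)
Definition cutjoin_upto (R : pzSemiRingType) (p : nat -> R) (d : nat -> R -> R)
    (M : nat) (f : R) : R :=
  \sum_(i < M) \sum_(j < M)
    (p (i + j)%N * d i (d j f) + p i * p j * d (i + j)%N f).

Section VertexOperator.
Variables (A : comNzRingType) (e p : nat -> A).
Variable d : nat -> {additive A -> A}.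
Hypotheses (p0 : p 0%N = 0) (d0 : forall f, d 0%N f = 0).
Hypothesis dM : forall k f g, d k (f * g) = d k f * g + f * d k g.
Hypothesis de : forall k j, (0 < k)%N ->
  d k (e j) = if (k <= j)%N then e (j - k)%N else 0.

Local Notation br := (bracket e).
Local Notation dz k := (map_poly (d k)).

Lemma map_derM k (X Y : {poly A}) : dz k (X * Y) = dz k X * Y + X * dz k Y.
Proof.
apply/polyP => n; rewrite coefD !coefM coef_map coefM raddf_sum -big_split.
by apply: eq_bigr => i _; rewrite dM !coef_map.
Qed.

(** By [de], the derivation [d k] multiplies e(1/z) by z^-k; this gives the second bracket, of index
    [m + k]. *)
Lemma der_bracket k m (X : {poly A}) :
  d k (br m X) = br m (dz k X) + (if (0 < k)%N then br (m + k) X else 0).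
Proof.
case: k => [|k].
  rewrite d0 addr0 (_ : dz 0 X = 0) ?linear0 //.
  by apply/polyP => i; rewrite coef_map coef0 d0.
have le_dX : (size (dz k.+1 X) <= size X)%N by apply: size_poly.
rewrite !(bracketE _ _ le_dX, bracketE _ _ (leqnn (size X))) raddf_sum -big_split.
apply: eq_bigr => a _; rewrite dM coef_map /=; congr (_ + _ * _).
case: (leqP m a) => [le_ma|lt_am]; last first.
  by rewrite raddf0 leqNgt (leq_trans lt_am) ?leq_addr.
by rewrite de // leq_subRL // subnDA.
Qed.

Variables (N M : nat) (F H : {poly A}).
Hypothesis thetaF : theta F = - \sum_(k < M) 'X^k * dz k F.
Hypothesis dF0 : forall k, (N <= k)%N -> dz k F = 0.
Hypothesis dH0 : forall k, dz k H = 0.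
Hypotheses (leN : (size F + size H <= N)%N) (leM : (N + N <= M)%N).

(** The shift of [p i]. It is 0 at index 0, where [p] is 0 and not a variable to be shifted. *)
Let zz (i : nat) : {poly A} := if (0 < i)%N then 'X^i else 0.

(** If [F] is f with each p_k replaced by p_k - z^k, this is the cut-and-join of f after the same
    replacement, which commutes with the derivations. *)
Let KF := \sum_(i < M) \sum_(j < M)
  (((p (i + j)%N)%:P - zz (i + j)) * dz i (dz j F)
   + ((p i)%:P - zz i) * ((p j)%:P - zz j) * dz (i + j)%N F).

(** Commutation of cut-and-join with the vertex operator: the right-hand side is the coefficient of
    z in (theta - theta^2) of the first factor, times [H]. Everything is expanded into elementary
    sums, with [thetaF] turning theta into the derivations. The terms linear in an index ([Q], [G])
    come from counting decompositions n = i + j. The Euler correction comes from the diagonal in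
    [stepE] and from the [- 1] in that count. *)
Lemma bracket_cutjoin :
  br 1 (KF * H) - cutjoin_upto p d M (br 1 (F * H))
    - (\sum_(k < M) p k * d k (br 1 (F * H))) *+ 2
  = - (br 1 (theta (theta F) * H)
       - (\sum_(k < M) p k * br k.+1 (theta F * H)) *+ 2
       + \sum_(k < M) \sum_(l < M) p k * p l * br (k + l).+1 (F * H)
       + \sum_(k < M) k%:R * p k * br k.+1 (F * H))
    + (br 1 (theta F * H) - \sum_(k < M) p k * br k.+1 (F * H)).
Proof.
have dz0 (X : {poly A}) : dz 0 X = 0.
  by apply/polyP => i; rewrite coef_map coef0 d0.
have br_large m (X : {poly A}) : (size X <= size F)%N -> (N <= m)%N -> br m (X * H) = 0.
  move=> leX leNm; apply: bracket_eq0; apply: leq_trans leNm.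
  rewrite (leq_trans (size_polyMleq _ _)) // (leq_trans (leq_pred _)) //.
  by apply: leq_trans leN; rewrite leq_add2r.
have leNM : (N <= M)%N by apply: leq_trans leM; apply: leq_addr.
pose S1 := \sum_(i < M) \sum_(j < M) p (i + j)%N * br 1 (dz i (dz j F) * H).
pose S2 := \sum_(i < M) \sum_(j < M) br 1 ('X^(i + j) * dz i (dz j F) * H).
pose S3 := \sum_(i < M) \sum_(j < M) p i * p j * br 1 (dz (i + j)%N F * H).
pose S4 := \sum_(i < M) \sum_(j < M) p i * br 1 (zz j * dz (i + j)%N F * H).
pose S5 := \sum_(i < M) \sum_(j < M) br 1 (zz i * zz j * dz (i + j)%N F * H).
pose T1 := \sum_(i < M) \sum_(j < M)
  (if (0 < i)%N then p (i + j)%N * br i.+1 (dz j F * H) else 0).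
pose T2 := \sum_(i < M) \sum_(j < M)
  (if (0 < i)%N && (0 < j)%N then p (i + j)%N * br (i + j).+1 (F * H) else 0).
pose T3 := \sum_(i < M) \sum_(j < M) p i * p j * br (i + j).+1 (F * H).
pose E1 := \sum_(k < M) p k * br 1 (dz k F * H).
pose E2 := \sum_(k < M) p k * br k.+1 (F * H).
pose Q := \sum_(k < M) k%:R * br 1 ('X^k * dz k F * H).
pose Q0 := \sum_(k < M) br 1 ('X^k * dz k F * H).
pose G := \sum_(k < M) k%:R * p k * br k.+1 (F * H).
have stepA : br 1 (KF * H) = S1 - S2 + S3 - S4 *+ 2 + S5.
  have brP c (X : {poly A}) : br 1 (c%:P * X) = c * br 1 X.
    by rewrite mul_polyC bracketZ.
  have -> : S4 *+ 2 = S4 + \sum_(i < M) \sum_(j < M)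
      p j * br 1 (zz i * dz (i + j)%N F * H).
    rewrite mulr2n {2}/S4 exchange_big; congr (_ + _).
    by apply: eq_bigr => i _; apply: eq_bigr => j _; rewrite addnC.
  rewrite /KF mulr_suml raddf_sum /S1 /S2 /S3 /S4 /S5 opprD addrA.
  rewrite -!sumrB -!big_split -!sumrB -!big_split; apply: eq_bigr => i _.
  rewrite mulr_suml raddf_sum /= -!sumrB -!big_split -!sumrB -!big_split.
  apply: eq_bigr => j _ /=; rewrite -!brP -!raddfB -!raddfD -!raddfB -!raddfD /=.
  congr (br 1 _).
  have zzE : zz (i + j) * dz i (dz j F) = 'X^(i + j) * dz i (dz j F).
    rewrite /zz addn_gt0; case: i j => [[|i] lti] [[|j] ltj] //=.
    by rewrite dz0 !mulr0.
  rewrite [X in (X + _) * H]mulrBl zzE polyCM.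
  move: (_%:P) (_%:P) (_%:P) ('X^_) (zz _) (zz _) (dz _ _) (dz _ _) => *.
  ring.
have stepB : cutjoin_upto p d M (br 1 (F * H)) = S1 + T1 *+ 2 + T2 + S3 + T3.
  have der1 k : d k (br 1 (F * H)) =
      br 1 (dz k F * H) + (if (0 < k)%N then br k.+1 (F * H) else 0).
    by rewrite der_bracket map_derM dH0 mulr0 addr0 add1n.
  have der2 i j : d i (d j (br 1 (F * H))) = br 1 (dz i (dz j F) * H)
      + (if (0 < i)%N then br i.+1 (dz j F * H) else 0)
      + (if (0 < j)%N then br j.+1 (dz i F * H) else 0)
      + (if (0 < i)%N && (0 < j)%N then br (i + j).+1 (F * H) else 0).
    rewrite der1 raddfD /= der_bracket map_derM dH0 mulr0 addr0 add1n -!addrA.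
    congr (_ + (_ + _)); case: (0 < j)%N; last by rewrite raddf0 andbF addr0.
    by rewrite der_bracket map_derM dH0 mulr0 addr0 addSn addnC andbT.
  have -> : T1 *+ 2 = T1 + \sum_(i < M) \sum_(j < M)
      (if (0 < j)%N then p (i + j)%N * br j.+1 (dz i F * H) else 0).
    rewrite mulr2n {2}/T1 exchange_big; congr (_ + _).
    by apply: eq_bigr => i _; apply: eq_bigr => j _; rewrite addnC.
  rewrite /cutjoin_upto /S1 /T1 /T2 /S3 /T3 addrA -!big_split; apply: eq_bigr => i _.
  rewrite -!big_split; apply: eq_bigr => j _ /=; rewrite der2 der1 !mulrDr !addrA.
  congr (_ + _ + _ + _ + _ + _).
  - by case: ifP; rewrite ?mulr0.
  - by case: ifP; rewrite ?mulr0.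
  - by case: ifP; rewrite ?mulr0.
  - case: ifP => //; case: i j => [[|i] lti] [[|j] ltj] //= _.
    by rewrite p0 !mul0r.
have stepC : \sum_(k < M) p k * d k (br 1 (F * H)) = E1 + E2.
  rewrite /E1 /E2 -big_split; apply: eq_bigr => k _ /=.
  rewrite der_bracket map_derM dH0 mulr0 addr0 mulrDr add1n; congr (_ + _).
  by case: posnP => // ->; rewrite p0 !mul0r.
have stepD0 : br 1 (theta F * H) = - Q0.
  by rewrite thetaF mulNr raddfN mulr_suml raddf_sum.
have stepD : br 1 (theta (theta F) * H) = S2 - Q.
  have theta_dz k : theta (dz k F) = - \sum_(l < M) 'X^l * dz k (dz l F).
    have thE : theta (dz k F) = dz k (theta F).
      apply/polyP => n; rewrite /theta coefXM coef_deriv !coef_map coefXM.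
      case: n => [|n]; first by rewrite raddf0.
      by rewrite /= coef_deriv raddfMn.
    have dzX l (X : {poly A}) : dz k ('X^l * X) = 'X^l * dz k X.
      apply/polyP => n; rewrite coef_map !coefXnM coef_map.
      by case: ifP; rewrite ?raddf0.
    rewrite thE thetaF raddfN raddf_sum /=; congr (- _); apply: eq_bigr => l _.
    exact: dzX.
  have thetaXn k (X : {poly A}) :
      theta ('X^k * X) = 'X^k * X *+ k + 'X^k * theta X.
    rewrite /theta derivM derivXn mulrDr; congr (_ + _); last by rewrite mulrCA.
    case: k => [|k]; first by rewrite !mulr0n mul0r mulr0.
    by rewrite mulrnAl mulrnAr mulrA -exprS.
  have -> : theta (theta F) =
      \sum_(i < M) \sum_(j < M) 'X^(i + j) * dz i (dz j F)
      - \sum_(k < M) 'X^k * dz k F *+ k.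
    have thetaN_sum (h : 'I_M -> {poly A}) :
        theta (- \sum_k h k) = - \sum_k theta (h k).
      by rewrite /theta raddfN raddf_sum mulrN mulr_sumr.
    rewrite {1}thetaF thetaN_sum -[RHS]opprB -sumrB; congr (- _).
    apply: eq_bigr => i _; rewrite thetaXn theta_dz mulrN mulr_sumr.
    by congr (_ - _); apply: eq_bigr => j _; rewrite exprD mulrA.
  rewrite mulrBl raddfB; congr (_ - _); rewrite mulr_suml raddf_sum.
    by apply: eq_bigr => i _; rewrite mulr_suml raddf_sum.
  by apply: eq_bigr => k _; rewrite /= mulr_natl mulrnAl raddfMn.
have stepE : \sum_(k < M) p k * br k.+1 (theta F * H) = - (S4 + E1 + T1).
  rewrite thetaF; under eq_bigr => k _.
    rewrite mulNr raddfN mulr_suml raddf_sum mulrN mulr_sumr; over.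
  rewrite /= sumrN; congr (- _).
  rewrite (sum_trichotomy (g := fun k l => p k * br k.+1 ('X^l * dz l F * H))).
    rewrite [S4 + E1]addrC; congr (_ + _ + _).
    - by apply: eq_bigr => k _; rewrite -mulrA -add1n bracketXn.
    - apply: eq_bigr => i _; rewrite big_mkcond; apply: eq_bigr => j _ /=.
      case: ifP => [j0|]; last first.
        by rewrite /zz => ->; rewrite !mul0r raddf0 mulr0.
      by rewrite /zz j0 exprD -!mulrA -add1n bracketXn.
    - rewrite /T1 [RHS]exchange_big; apply: eq_bigr => i _.
      rewrite [LHS]big_mkcond; apply: eq_bigr => j _ /=; case: ifP => // j0.
      by rewrite addnC -addSn -mulrA bracketXn.
  (* Here [N + N <= M] is used: if [l < N] and [M <= k], then after cancelling z^l the index of the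
     bracket still exceeds the degree of the product. *)
  move=> k l leM_kl; have [leNl|ltlN] := leqP N l.
    by rewrite dF0 // mulr0 mul0r raddf0 mulr0.
  case/orP: leM_kl => [leMk|/(leq_trans leNM)]; last by rewrite leqNgt ltlN.
  have le_lk : (l <= k)%N by apply: leq_trans (ltnW ltlN) (leq_trans leNM leMk).
  rewrite -(subnK le_lk) -addSn -mulrA bracketXn br_large ?mulr0 ?size_poly //.
  rewrite ltnW // ltnS leq_subRL // (leq_trans _ leMk) // (leq_trans _ leM) //.
  by rewrite leq_add2r ltnW.
have stepF5 : S5 = Q - Q0.
  have -> : S5 = \sum_(i < M) \sum_(j < M) (if (0 < i)%N && (0 < j)%N
      then br 1 ('X^(i + j) * dz (i + j)%N F * H) else 0).
    apply: eq_bigr => i _; apply: eq_bigr => j _; rewrite /zz.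
    do 2![case: ifP => /= _; rewrite ?(mul0r, mulr0, raddf0) //].
    by rewrite exprD.
  rewrite (sum_triangle_pos (g := fun n => br 1 ('X^n * dz n F * H))) => [|n leMn].
    congr (_ - _); rewrite /Q0 big_mkcond; apply: eq_bigr => n _ /=.
    by case: posnP => // ->; rewrite dz0 mulr0 mul0r raddf0.
  by rewrite dF0 ?mulr0 ?mul0r ?raddf0 // (leq_trans leNM).
have stepF2 : T2 = G - E2.
  rewrite /T2 (sum_triangle_pos (g := fun n => p n * br n.+1 (F * H))).
    congr (_ - _); first by apply: eq_bigr => n _; rewrite mulrA.
    rewrite /E2 big_mkcond; apply: eq_bigr => n _ /=.
    by case: posnP => // ->; rewrite p0 mul0r.
  by move=> n leMn; rewrite br_large ?mulr0 // ltnW // ltnS (leq_trans leNM).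
rewrite stepA stepB stepC stepD0 stepD stepE stepF5 stepF2 -/E2 -/T3 -/G.
ring.
Qed.

End VertexOperator.

Lemma theta_mul (A : comNzRingType) (X Y : {poly A}) :
  theta (X * Y) = theta X * Y + X * theta Y.
Proof. by rewrite /theta derivM mulrDr mulrA mulrCA. Qed.

Section Residue.
Variables (A : comNzRingType) (e p p' : nat -> A).
Hypotheses (p0 : p 0%N = 0) (p'0 : p' 0%N = 0).
Hypothesis e_rec : forall j,
  j%:R * e j = \sum_(k < j.+1) (p k + p' k) * e (j - k)%N.
Variable M : nat.

Local Notation br := (bracket e).

(* The coefficient of z in (theta a - theta^2 a) b, where theta = z d/dz,
   a = exp (sum_k p_k z^-k / k) F and b = exp (sum_k p'_k z^-k / k) H. *)
Definition residue_half (r : nat -> A) (F H : {poly A}) : A :=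
  - (br 1 (theta (theta F) * H)
     - (\sum_(k < M) r k * br k.+1 (theta F * H)) *+ 2
     + \sum_(k < M) \sum_(l < M) r k * r l * br (k + l).+1 (F * H)
     + \sum_(k < M) k%:R * r k * br k.+1 (F * H))
  + (br 1 (theta F * H) - \sum_(k < M) r k * br k.+1 (F * H)).

(* The difference of the two sides is the coefficient of z in W - theta W, where
   W = theta a * b - a * theta b; and 1 - theta kills this coefficient. *)
Lemma residue_half_sym (F H : {poly A}) : (size F + size H <= M)%N ->
  residue_half p F H = residue_half p' H F.
Proof.
move=> leM.
have le_size (X Y : {poly A}) : (size X <= size F)%N -> (size Y <= size H)%N ->
    (size (X * Y)%R <= M)%N.
  move=> leX leY; rewrite (leq_trans (size_polyMleq _ _)) //.
  rewrite (leq_trans (leq_pred _)) // (leq_trans _ leM) // leq_add //.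
have q0 : p 0%N + p' 0%N = 0 by rewrite p0 p'0 addr0.
have brth m (X : {poly A}) : (size X <= M)%N ->
    br m (theta X) = m%:R * br m X + \sum_(k < M) (p k + p' k) * br (m + k) X.
  by move=> leX; apply: (bracket_theta (q := fun k => p k + p' k)).
pose X := theta F * H - F * theta H.
(* The two second-order terms differ by theta of the first-order part [X] of the Wronskian, so
   [bracket_theta] removes them. *)
have brX : br 1 (theta (theta F) * H) - br 1 (F * theta (theta H))
    = br 1 (theta F * H) - br 1 (F * theta H)
      + \sum_(k < M) (p k + p' k) * (br k.+1 (theta F * H) - br k.+1 (F * theta H)).
  have -> : br 1 (theta (theta F) * H) - br 1 (F * theta (theta H)) = br 1 (theta X).
    rewrite -raddfB /=; congr (br 1 _); rewrite /X.
    have -> : theta (theta F * H - F * theta H)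
        = theta (theta F * H) - theta (F * theta H).
      by rewrite /theta raddfB mulrBr.
    by rewrite !theta_mul; ring.
  rewrite brth; last first.
    rewrite (leq_trans (size_polyD _ _)) // geq_max.
    by rewrite size_polyN !le_size ?size_theta.
  rewrite mul1r /X raddfB; congr (_ + _); apply: eq_bigr => k _.
  by rewrite add1n raddfB.
have brFH k : br k.+1 (theta F * H) + br k.+1 (F * theta H)
    = k.+1%:R * br k.+1 (F * H)
      + \sum_(l < M) (p l + p' l) * br (k + l).+1 (F * H).
  by rewrite -raddfD -theta_mul /= brth ?le_size.
have sym : \sum_(k < M) \sum_(l < M) p k * p' l * br (k + l).+1 (F * H)
    = \sum_(k < M) \sum_(l < M) p' k * p l * br (k + l).+1 (F * H).
  rewrite exchange_big; apply: eq_bigr => k _; apply: eq_bigr => l _.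
  by rewrite addnC (mulrC (p' k)).
(* Arranged so that the last sum contains theta F * H + F * theta H, which is theta (F * H) and is
   again accessible to [bracket_theta]. *)
have splitU : \sum_(k < M) (p k + p' k) * (br k.+1 (theta F * H) - br k.+1 (F * theta H))
    = (\sum_(k < M) p k * br k.+1 (theta F * H)) *+ 2
      - (\sum_(k < M) p' k * br k.+1 (F * theta H)) *+ 2
      - \sum_(k < M) (p k - p' k) * (br k.+1 (theta F * H) + br k.+1 (F * theta H)).
  by rewrite -!sumrMnl -!sumrB; apply: eq_bigr => k _; ring.
have splitV : \sum_(k < M) (p k - p' k) * (br k.+1 (theta F * H) + br k.+1 (F * theta H))
    = \sum_(k < M) k%:R * p k * br k.+1 (F * H) + \sum_(k < M) p k * br k.+1 (F * H)
      - (\sum_(k < M) k%:R * p' k * br k.+1 (F * H) + \sum_(k < M) p' k * br k.+1 (F * H))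
      + (\sum_(k < M) \sum_(l < M) p k * p l * br (k + l).+1 (F * H)
         + \sum_(k < M) \sum_(l < M) p k * p' l * br (k + l).+1 (F * H)
         - \sum_(k < M) \sum_(l < M) p' k * p l * br (k + l).+1 (F * H)
         - \sum_(k < M) \sum_(l < M) p' k * p' l * br (k + l).+1 (F * H)).
  rewrite -!(big_split, sumrB) /=; apply: eq_bigr => k _.
  rewrite brFH mulrDr; congr (_ + _); first by rewrite -natr1; ring.
  by rewrite mulr_sumr -!(big_split, sumrB) /=; apply: eq_bigr => l _; ring.
rewrite /residue_half ![H * _]mulrC [theta H * _]mulrC [theta (theta H) * _]mulrC.
move/(canRL (subrK _)): brX => ->; rewrite splitU splitV sym.
ring.
Qed.

End Residue.

Lemma sum_ord_widen (V : nmodType) (g : nat -> V) N M :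
    (N <= M)%N -> (forall i, (N <= i)%N -> g i = 0) ->
  \sum_(i < M) g i = \sum_(i < N) g i.
Proof.
move=> leNM g0; rewrite (big_ord_widen M g leNM) [RHS]big_mkcond.
by apply: eq_bigr => i _; case: ltnP => // /g0.
Qed.

Section CutJoin.
Variables (R : comNzRingType) (p : nat -> R) (d : nat -> {additive R -> R}).
Variable bound : R -> nat.
Hypothesis d_comm : forall i j f, d i (d j f) = d j (d i f).
Hypothesis d_bound : forall f k, (bound f <= k)%N -> d k f = 0.

Lemma cutjoin_upto_widen N M f :
    (N <= M)%N -> (forall k, (N <= k)%N -> d k f = 0) ->
  cutjoin_upto p d M f = cutjoin_upto p d N f.
Proof.
move=> leNM df0; have t0 i j : (N <= i)%N || (N <= j)%N ->
    p (i + j)%N * d i (d j f) + p i * p j * d (i + j)%N f = 0.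
  move=> leN; rewrite [d (i + j)%N f]df0; last first.
    by case/orP: leN => leN; apply: leq_trans leN _; rewrite ?leq_addr ?leq_addl.
  rewrite mulr0 addr0; case/orP: leN => /df0; last by move->; rewrite raddf0 mulr0.
  by rewrite d_comm => ->; rewrite raddf0 mulr0.
pose g i j := p (i + j)%N * d i (d j f) + p i * p j * d (i + j)%N f.
rewrite /cutjoin_upto (@sum_ord_widen _ (fun i => \sum_(j < M) g i j) _ _ leNM).
  apply: eq_bigr => i _; apply: (@sum_ord_widen _ (g i) _ _ leNM) => j leNj.
  by rewrite /g t0 ?leNj ?orbT.
by move=> i leNi; rewrite big1 // => j _; rewrite /g t0 ?leNi.
Qed.

(* Twice the cut-and-join operator, and the Euler field, when p_k is a variable
   of weight k and d_k = k d/dp_k. *)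
Definition cutjoin (f : R) : R := cutjoin_upto p d (bound f) f.
Definition euler (f : R) : R := \sum_(k < bound f) p k * d k f.

Lemma cutjoinE N f : (forall k, (N <= k)%N -> d k f = 0) ->
  cutjoin f = cutjoin_upto p d N f.
Proof.
move=> df0; rewrite /cutjoin -(cutjoin_upto_widen (leq_maxl (bound f) N)).
  by rewrite (cutjoin_upto_widen (leq_maxr (bound f) N)).
exact: d_bound.
Qed.

Lemma eulerE N f : (forall k, (N <= k)%N -> d k f = 0) ->
  euler f = \sum_(k < N) p k * d k f.
Proof.
move=> df0; pose h k := p k * d k f.
rewrite /euler -(@sum_ord_widen _ h _ _ (leq_maxl (bound f) N)); last first.
  by move=> i /d_bound dif0; rewrite /h dif0 mulr0.
by apply: (@sum_ord_widen _ h); [exact: leq_maxr | move=> i /df0 h0; rewrite /h h0 mulr0].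
Qed.

Let bound2 f g k : (maxn (bound f) (bound g) <= k)%N -> d k f = 0 /\ d k g = 0.
Proof. by rewrite geq_max => /andP[/d_bound-> /d_bound->]. Qed.

(** The truncation depends on the argument, so additivity is read off only after all three sums are
    brought to a common bound. *)
Lemma cutjoinB f g : cutjoin (f - g) = cutjoin f - cutjoin g.
Proof.
have b2 := @bound2 f g.
rewrite !(@cutjoinE (maxn (bound f) (bound g))); try by
  move=> k /b2[df dg]; rewrite ?raddfB ?df ?dg ?subr0.
rewrite /cutjoin_upto -sumrB; apply: eq_bigr => i _.
by rewrite -sumrB; apply: eq_bigr => j _; rewrite !raddfB /=; ring.
Qed.

Lemma eulerB f g : euler (f - g) = euler f - euler g.
Proof.
have b2 := @bound2 f g.
rewrite !(@eulerE (maxn (bound f) (bound g))); try by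
  move=> k /b2[df dg]; rewrite ?raddfB ?df ?dg ?subr0.
by rewrite -sumrB; apply: eq_bigr => i _; rewrite raddfB mulrBr.
Qed.

End CutJoin.

(** * The Hirota bilinear form and the operators that it intertwines *)

Section Hirota.
Variables (R A : comNzRingType) (pR : nat -> R) (dR : nat -> {additive R -> R}).
Variables (boundR : R -> nat) (p p' : nat -> A) (d d' : nat -> {additive A -> A}).
Variables (bound bound' : A -> nat) (e : nat -> A).
Variables minus plus : {rmorphism R -> {poly A}}.

Hypothesis dR_comm : forall i j f, dR i (dR j f) = dR j (dR i f).
Hypothesis dR_bound : forall f k, (boundR f <= k)%N -> dR k f = 0.
Hypothesis d_comm : forall i j f, d i (d j f) = d j (d i f).
Hypothesis d_bound : forall f k, (bound f <= k)%N -> d k f = 0.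
Hypothesis d'_comm : forall i j f, d' i (d' j f) = d' j (d' i f).
Hypothesis d'_bound : forall f k, (bound' f <= k)%N -> d' k f = 0.
Hypotheses (p0 : p 0%N = 0) (d0 : forall f, d 0%N f = 0).
Hypotheses (p'0 : p' 0%N = 0) (d'0 : forall f, d' 0%N f = 0).
Hypothesis dM : forall k f g, d k (f * g) = d k f * g + f * d k g.
Hypothesis d'M : forall k f g, d' k (f * g) = d' k f * g + f * d' k g.
Hypothesis de : forall k j, (0 < k)%N ->
  d k (e j) = if (k <= j)%N then e (j - k)%N else 0.
Hypothesis d'e : forall k j, (0 < k)%N ->
  d' k (e j) = if (k <= j)%N then - e (j - k)%N else 0.
Hypothesis e_rec : forall j,
  j%:R * e j = \sum_(k < j.+1) (p k - p' k) * e (j - k)%N.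

Let zz (i : nat) : {poly A} := if (0 < i)%N then 'X^i else 0.
Hypothesis minus_p : forall k, minus (pR k) = (p k)%:P - zz k.
Hypothesis plus_p : forall k, plus (pR k) = (p' k)%:P + zz k.
Hypothesis minus_d : forall k f, minus (dR k f) = map_poly (d k) (minus f).
Hypothesis plus_d : forall k f, plus (dR k f) = map_poly (d' k) (plus f).
Hypothesis minus_d' : forall k f, map_poly (d' k) (minus f) = 0.
Hypothesis plus_d' : forall k f, map_poly (d k) (plus f) = 0.
Hypothesis minus_theta : forall N f, (boundR f <= N)%N ->
  theta (minus f) = - \sum_(k < N) 'X^k * map_poly (d k) (minus f).
Hypothesis plus_theta : forall N f, (boundR f <= N)%N ->
  theta (plus f) = \sum_(k < N) 'X^k * map_poly (d' k) (plus f).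

Definition hirota (f g : R) : A := bracket e 1 (minus f * plus g).

Let KR := cutjoin pR dR boundR.
(** The Euler fields have opposite signs because the dual vertex operator arises by changing the
    signs of p' and d': cut-and-join has three factors in each term and changes sign, the Euler
    field has two and does not. *)
Let KA f := cutjoin p d bound f + euler p d bound f *+ 2
            + cutjoin p' d' bound' f - euler p' d' bound' f *+ 2.

(** Each factor contributes a [residue_half], with opposite signs; [residue_half_sym] makes them
    cancel. *)
Lemma hirota_cutjoin f g :
  hirota (KR f) g + hirota f (KR g) = KA (hirota f g).
Proof.
set F := minus f; set H := plus g; pose h := hirota f g.
pose N := (boundR f + boundR g + (size F + size H) + bound h + bound' h)%N.
have leN : [/\ (boundR f <= N)%N, (boundR g <= N)%N, (size F + size H <= N)%N,
    (bound h <= N)%N & (bound' h <= N)%N].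
  by rewrite /N; split; lia.
case: leN => leN_f leN_g leN_FH leN_h leN_h'.
pose M := (N + N)%N; have leNM : (N <= M)%N by apply: leq_addr.
(* After a change of sign, the variables p' play the same role as the p. *)
pose q k := - p' k; pose dq k : {additive A -> A} := (-%R \o d' k)%FUN.
have map_dq k (X : {poly A}) : map_poly (dq k) X = - map_poly (d' k) X.
  by apply/polyP => i; rewrite coefN !coef_map.
have K1 : bracket e 1 (minus (KR f) * H)
    = cutjoin p d bound h + euler p d bound h *+ 2 + residue_half e M p F H.
  have dR0 k : (M <= k)%N -> dR k f = 0.
    by move=> leMk; apply: dR_bound; apply: leq_trans leMk; apply: leq_trans leNM.
  have d0h k : (M <= k)%N -> d k h = 0.
    by move=> leMk; apply: d_bound; apply: leq_trans leMk; apply: leq_trans leNM.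
  rewrite /KR (cutjoinE _ dR_comm dR_bound dR0) (cutjoinE _ d_comm d_bound d0h).
  rewrite (eulerE _ d_bound d0h) raddf_sum /=.
  have dF0 k : (N <= k)%N -> map_poly (d k) F = 0.
    by move=> leNk; rewrite -minus_d dR_bound ?raddf0 // (leq_trans leN_f).
  have := bracket_cutjoin p0 d0 dM de (minus_theta (leq_trans leN_f leNM)) dF0
    (plus_d' ^~ g) leN_FH (leqnn M).
  rewrite -/(residue_half e M p F H) => <-.
  rewrite -/(hirota f g) -/h -[X in _ = _ + X]addrA -opprD [RHS]addrC subrK; congr (bracket e 1 (_ * H)).
  apply: eq_bigr => i _; rewrite raddf_sum; apply: eq_bigr => j _ /=.
  by rewrite rmorphD !rmorphM /= !minus_p !minus_d.
have K2 : bracket e 1 (F * plus (KR g))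
    = cutjoin p' d' bound' h - euler p' d' bound' h *+ 2 - residue_half e M q H F.
  have dR0 k : (M <= k)%N -> dR k g = 0.
    by move=> leMk; apply: dR_bound; apply: leq_trans leMk; apply: leq_trans leNM.
  have d0h k : (M <= k)%N -> d' k h = 0.
    by move=> leMk; apply: d'_bound; apply: leq_trans leMk; apply: leq_trans leNM.
  rewrite /KR (cutjoinE _ dR_comm dR_bound dR0) (cutjoinE _ d'_comm d'_bound d0h).
  rewrite (eulerE _ d'_bound d0h) raddf_sum /=.
  have dq0 x : dq 0%N x = 0 by rewrite /= d'0 oppr0.
  have dqM k x y : dq k (x * y) = dq k x * y + x * dq k y.
    by rewrite /= d'M; ring.
  have dqe k j : (0 < k)%N -> dq k (e j) = if (k <= j)%N then e (j - k)%N else 0.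
    by move=> k0; rewrite /= d'e //; case: ifP; rewrite ?oppr0 ?opprK.
  have q0 : q 0%N = 0 by rewrite /q p'0 oppr0.
  have thH : theta H = - \sum_(k < M) 'X^k * map_poly (dq k) H.
    rewrite (plus_theta (leq_trans leN_g leNM)) -sumrN; apply: eq_bigr => k _.
    by rewrite map_dq mulrN opprK.
  have dH0 k : (N <= k)%N -> map_poly (dq k) H = 0.
    by move=> leNk; rewrite map_dq -plus_d dR_bound ?raddf0 ?oppr0 // (leq_trans leN_g).
  have dF0 k : map_poly (dq k) F = 0 by rewrite map_dq minus_d' oppr0.
  rewrite addnC in leN_FH.
  have := bracket_cutjoin q0 dq0 dqM dqe thH dH0 dF0 leN_FH (leqnn M).
  rewrite -/(residue_half e M q H F) => <-.
  rewrite [H * F]mulrC -/(hirota f g) -/h.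
  have -> : cutjoin_upto q dq M h = - cutjoin_upto p' d' M h.
    rewrite /cutjoin_upto -sumrN; apply: eq_bigr => i _.
    rewrite -sumrN; apply: eq_bigr => j _; rewrite /q /= raddfN; ring.
  have -> : \sum_(k < M) q k * dq k h = \sum_(k < M) p' k * d' k h.
    by apply: eq_bigr => k _; rewrite /q mulrNN.
  set KH := (X in bracket e 1 (X * F)).
  have -> : \sum_(i < M) plus (\sum_(j < M) (pR (i + j)%N * dR i (dR j g)
      + pR i * pR j * dR (i + j)%N g)) = - KH.
    rewrite /KH -sumrN; apply: eq_bigr => i _; rewrite raddf_sum -sumrN.
    apply: eq_bigr => j _ /=; rewrite rmorphD !rmorphM /= !plus_p !plus_d.
    rewrite !map_dq raddfN /= /q !polyCN.
    rewrite -/(zz (i + j)) -/(zz i) -/(zz j).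
    move: (zz _) (zz _) (zz _) => *; ring.
  rewrite mulrN raddfN [F * KH]mulrC /=; ring.
rewrite /hirota K1 K2 /KA -/h (@residue_half_sym _ _ p q).
- ring.
- by [].
- by rewrite /q p'0 oppr0.
- exact: e_rec.
- exact: leq_trans leNM.
Qed.

Lemma hirotaBl f1 f2 g : hirota (f1 - f2) g = hirota f1 g - hirota f2 g.
Proof. by rewrite /hirota rmorphB /= mulrBl raddfB. Qed.

Lemma hirotaBr f g1 g2 : hirota f (g1 - g2) = hirota f g1 - hirota f g2.
Proof. by rewrite /hirota rmorphB /= mulrBr raddfB. Qed.

Lemma hirotaDl f1 f2 g : hirota (f1 + f2) g = hirota f1 g + hirota f2 g.
Proof. by rewrite /hirota rmorphD /= mulrDl raddfD. Qed.

Lemma hirotaDr f g1 g2 : hirota f (g1 + g2) = hirota f g1 + hirota f g2.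
Proof. by rewrite /hirota rmorphD /= mulrDr raddfD. Qed.

Let KAB : {morph KA : x y / x - y}.
Proof. by move=> x y; rewrite /KA !cutjoinB ?eulerB //; ring. Qed.

(* In the fermionic picture, these [a] are the elements of gl(oo). *)
Definition preserves (a : R -> R) (b : A -> A) :=
  forall f g, hirota (a f) g + hirota f (a g) = b (hirota f g).

Definition commutator (V : zmodType) (a b : V -> V) (f : V) : V :=
  a (b f) - b (a f).

Lemma commutatorB (V : zmodType) (a b : V -> V) :
    {morph a : x y / x - y} -> {morph b : x y / x - y} ->
  {morph commutator a b : x y / x - y}.
Proof.
move=> aB bB x y; rewrite /commutator aB bB aB bB.
by rewrite !opprD !opprK addrACA.
Qed.

Lemma morphB_D (V : zmodType) (b : V -> V) :
  {morph b : x y / x - y} -> {morph b : x y / x + y}.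
Proof.
move=> bB x y; have b0 : b 0 = 0 by rewrite -{1}(subrr 0) bB subrr.
by rewrite -[y in LHS]opprK bB -[- y]sub0r bB b0 sub0r opprK.
Qed.

(** The operators a (x) 1 and 1 (x) a' commute, so the mixed terms cancel and the commutator of the
    two sums again has the form c (x) 1 + 1 (x) c. *)
Lemma preserves_commutator a b a' b' :
    {morph b : x y / x - y} -> {morph b' : x y / x - y} ->
  preserves a b -> preserves a' b' ->
  preserves (commutator a a') (commutator b b').
Proof.
move=> /morphB_D bD /morphB_D b'D ab ab' f g; rewrite /commutator.
rewrite hirotaBl hirotaBr -ab -ab' bD b'D -!ab -!ab'; ring.
Qed.

(** Serves for coefficients in the formal parameters, which neither shift affects. *)
Lemma preserves_scale c c' a b :
    minus c = c'%:P -> plus c = c'%:P -> preserves a b ->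
  preserves (fun f => c * a f) (fun f => c' * b f).
Proof.
move=> mc pc ab f g; rewrite -ab /hirota !rmorphM /= mc pc mulrDr.
rewrite -!bracketZ -!mul_polyC.
by congr (bracket e 1 _ + bracket e 1 _); ring.
Qed.

Lemma preserves_add a b a' b' :
    preserves a b -> preserves a' b' ->
  preserves (fun f => a f + a' f) (fun f => b f + b' f).
Proof. by move=> ab ab' f g; rewrite -ab -ab' hirotaDl hirotaDr addrACA. Qed.

(** As [KR] is twice the cut-and-join operator K, the choice c1 = 4uv, c2 = 2(u+v) gives four times
    u v p_1 + (u+v) [K, p_1] + [K, [K, p_1]]. *)
Definition evolution (c1 c2 : R) (f : R) : R :=
  c1 * (pR 1%N * f) + c2 * commutator KR ( *%R (pR 1%N)) f
  + commutator KR (commutator KR ( *%R (pR 1%N))) f.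

Variables (c1 c2 : R) (c1' c2' : A).
Hypotheses (minus_c1 : minus c1 = c1'%:P) (plus_c1 : plus c1 = c1'%:P).
Hypotheses (minus_c2 : minus c2 = c2'%:P) (plus_c2 : plus c2 = c2'%:P).

Lemma preserves_evolution :
  exists b : A -> A, {morph b : x y / x - y} /\ preserves (evolution c1 c2) b.
Proof.
(* The two shifts turn p_1 into p_1 - z and p'_1 + z; in the sum z cancels, so the factor leaves the
   bracket. *)
pose P : A -> A := *%R (p 1%N + p' 1%N).
have PB : {morph P : x y / x - y} by move=> x y; rewrite /P mulrBr.
have pP : preserves ( *%R (pR 1%N)) P.
  move=> f g; rewrite /hirota /P !rmorphM /= minus_p plus_p mulrDl -!bracketZ.
  by rewrite -!raddfD -!mul_polyC /=; congr (bracket e 1 _); ring.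
have KP := preserves_commutator KAB PB hirota_cutjoin pP.
have KPB := commutatorB KAB PB.
have KKP := preserves_commutator KAB KPB hirota_cutjoin KP.
have KKPB := commutatorB KAB KPB.
exists (fun f => c1' * P f + c2' * commutator KA P f + commutator KA (commutator KA P) f).
split; last first.
  by apply: preserves_add; first apply: preserves_add; [apply: preserves_scale..|].
move=> x y; rewrite PB KPB KKPB; ring.
Qed.

Hypothesis A_torsion_free : forall n (x : A), n.+1%:R * x = 0 -> x = 0.
Variable Z : nat -> R.
Hypothesis Z0 : Z 0%N = 1.
Hypothesis Z_rec : forall n, Z n.+1 *+ (4 * n.+1) = evolution c1 c2 (Z n).

Lemma hirota_bilinear n : \sum_(a < n.+1) hirota (Z a) (Z (n - a)%N) = 0.
Proof.
have [b [bB evb]] := preserves_evolution.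
have bD := morphB_D bB; have b0 : b 0 = 0 by rewrite -{1}(subrr 0) bB subrr.
have hMl k f g : hirota (f *+ k) g = hirota f g *+ k.
  by rewrite /hirota rmorphMn /= mulrnAl raddfMn.
have hMr k f g : hirota f (g *+ k) = hirota f g *+ k.
  by rewrite /hirota rmorphMn /= mulrnAr raddfMn.
elim: n => [|n IHn].
  (* The constant polynomial 1 has no coefficient at z, and e(1/z) contributes only nonpositive
     powers of z. *)
  by rewrite big_ord1 Z0 /hirota !rmorph1 mulr1 bracket_eq0 ?size_poly1.
have /esym := congr1 b IHn; rewrite b0 (big_morph b bD b0).
under eq_bigr => a _ do rewrite -evb -!Z_rec.
have -> : \sum_(a < n.+1) (hirota (Z a.+1 *+ (4 * a.+1)) (Z (n - a)%N)
    + hirota (Z a) (Z (n - a).+1 *+ (4 * (n - a).+1)))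
    = \sum_(a < n.+2) hirota (Z a) (Z (n.+1 - a)%N) *+ (4 * n.+1).
  rewrite big_split /=.
  (* After reindexing, the pair (a, n+1-a) receives the weights 4a and 4(n+1-a), whose sum does not
     depend on a. The added extreme terms have weight 0. *)
  transitivity (\sum_(a < n.+2) hirota (Z a *+ (4 * a)) (Z (n.+1 - a)%N)
    + \sum_(a < n.+2) hirota (Z a) (Z (n.+1 - a)%N *+ (4 * (n.+1 - a)))).
    congr (_ + _); first by rewrite [RHS]big_ord_recl /= hMl muln0 mulr0n add0r.
    rewrite [RHS]big_ord_recr /= subnn hMr muln0 mulr0n addr0.
    by apply: eq_bigr => a _; rewrite subSn // -ltnS.
  rewrite -big_split; apply: eq_bigr => a _ /=.
  by rewrite hMl hMr -mulrnDr -mulnDr subnKC // -ltnS.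
rewrite sumrMnl => /esym; rewrite -mulr_natl.
by apply: (A_torsion_free (n := (4 * n.+1).-1)).
Qed.

End Hirota.

(** * Exponentials of series and the KP tau functions *)

Section SeriesExp.
Variables (R : comAlgType rat) (f : nat -> R).
Hypothesis f0 : f 0%N = 0.

(** Truncation makes [f] a polynomial without changing these coefficients, so that derivatives of
    polynomials become available. *)
Lemma series_powE N i j : (j <= N)%N ->
  series_pow f i j = ((\poly_(k < N.+1) f k) ^+ i)`_j.
Proof.
elim: i j => [|i IHi] j le_jN; first by rewrite expr0 coef1.
have -> : series_pow f i.+1 j = \sum_(k < j.+1) f k * series_pow f i (j - k)%N by [].
rewrite exprS coefM; apply: eq_bigr => k _.
have le_kj : (k <= j)%N by rewrite -ltnS.
rewrite coef_poly ltnS (leq_trans le_kj le_jN) IHi //.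
exact: leq_trans (leq_subr _ _) le_jN.
Qed.

Let coef_pow_small N i j : (j < i)%N -> ((\poly_(k < N.+1) f k) ^+ i)`_j = 0.
Proof.
have -> : \poly_(k < N.+1) f k = 'X * \poly_(k < N) f k.+1.
  by apply/polyP => -[|k]; rewrite coefXM !coef_poly.
by move=> lt_ji; rewrite exprMn coefXnM lt_ji.
Qed.

(** Coefficient form of (exp f)' = f' exp f. For the truncated exponential [W] differentiation loses
    one power of [P], which does not reach the degrees considered because [f] has no constant
    term. *)
Lemma series_exp_rec n :
  n%:R * series_exp f n = \sum_(k < n.+1) k%:R * f k * series_exp f (n - k)%N.
Proof.
case: n => [|n]; first by rewrite big_ord1 !mul0r.
pose P := \poly_(k < n.+2) f k.
pose c i : R := (i`!%:R^-1 : rat)%:A.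
have cS i : c i.+1 *+ i.+1 = c i.
  rewrite /c -scaler_nat scalerA factS natrM invfM mulrA divff ?pnatr_eq0 //.
  by rewrite mul1r.
pose W m := \sum_(i < m) c i *: P ^+ i.
have expE j : (j <= n.+1)%N -> series_exp f j = (W n.+2)`_j.
  move=> le_j; rewrite coef_sum /series_exp.
  pose g i : R := (i`!%:R^-1 : rat) *: (P ^+ i)`_j.
  under [RHS]eq_bigr => i _ do rewrite coefZ mulr_algl.
  transitivity (\sum_(i < n.+2) g i).
    rewrite (@sum_ord_widen _ g j.+1) // => [|i ltji]; last first.
      by rewrite /g coef_pow_small ?scaler0.
    by apply: eq_bigr => i _; rewrite (series_powE _ le_j).
  by apply: eq_bigr.
have dW : (W n.+2)^`() = P^`() * W n.+1.
  rewrite /W big_ord_recl expr0 derivD derivZ derivC scaler0 add0r.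
  rewrite raddf_sum mulr_sumr; apply: eq_bigr => i _ /=.
  rewrite /bump /= add1n derivZ deriv_exp /= -scalerAr -[c i in RHS]cS.
  by rewrite -scalerMnl scalerMnr.
have -> : n.+1%:R * series_exp f n.+1 = (P^`() * W n.+1)`_n.
  by rewrite -dW coef_deriv mulr_natl expE.
rewrite coefM [RHS]big_ord_recl !mul0r add0r; apply: eq_bigr => k _.
rewrite lift0 subSS coef_deriv coef_poly ltnS ltn_ord mulr_natl; congr (_ * _).
have le_nk : (n - k <= n)%N by apply: leq_subr.
rewrite expE ?leqW // /W [in RHS]big_ord_recr coefD coefZ /=.
by rewrite coef_pow_small ?mulr0 ?addr0.
Qed.

End SeriesExp.

HB.lock Definition pvar (I : choiceType) (x : nat -> I) (k : nat) : mpolyQ I :=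
  if k is i.+1 then mvar (x i) else 0.

(** The derivative with respect to the KP time t_k = p_k / k. *)
HB.lock Definition pder (I : choiceType) (x : nat -> I) (k : nat)
    (f : mpolyQ I) : mpolyQ I :=
  pderiv (x k.-1) f *+ k.

Lemma pvar0 (I : choiceType) (x : nat -> I) : pvar x 0 = 0.
Proof. by rewrite pvar.unlock. Qed.

Lemma pvarS (I : choiceType) (x : nat -> I) i : pvar x i.+1 = mvar (x i).
Proof. by rewrite pvar.unlock. Qed.

Section PowerSums.
Variables (I : choiceType) (x : nat -> I).

Lemma pder_is_nmod_morphism k : nmod_morphism (pder x k).
Proof.
rewrite pder.unlock; split; first by rewrite raddf0 mul0rn.
by move=> f g; rewrite pderivD mulrnDl.
Qed.

HB.instance Definition _ k :=
  GRing.isNmodMorphism.Build _ _ (pder x k) (pder_is_nmod_morphism k).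

Lemma pderM k f g : pder x k (f * g) = pder x k f * g + f * pder x k g.
Proof. by rewrite pder.unlock pderivM mulrnDl mulrnAl mulrnAr. Qed.

Lemma pder0 f : pder x 0 f = 0.
Proof. by rewrite pder.unlock mulr0n. Qed.

Lemma pderC k (a : rat) : pder x k a%:MP = 0.
Proof. by rewrite pder.unlock pderivC mul0rn. Qed.

Lemma pderX k i : pder x k (mvar i) = (x k.-1 == i)%:R *+ k.
Proof. by rewrite pder.unlock pderivX. Qed.

Lemma pder_bound (index : I -> nat) (indexK : forall k, index (x k) = k.+1) f k :
  (var_bound index f <= k)%N -> pder x k f = 0.
Proof.
rewrite pder.unlock; case: k => [|k]; first by rewrite mulr0n.
by rewrite -[in X in (X -> _)](indexK k) => /pderiv_eq0 ->; rewrite mul0rn.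
Qed.

End PowerSums.

Lemma pder_comm (I : choiceType) (x y : nat -> I) i j f :
  pder x i (pder y j f) = pder y j (pder x i f).
Proof.
by rewrite pder.unlock !raddfMn /= pderiv_comm -!mulrnA mulnC.
Qed.

Lemma theta_polyC (A : nzRingType) (c : A) : theta c%:P = 0.
Proof. by rewrite /theta derivC mulr0. Qed.

Lemma thetaD (A : nzRingType) (X Y : {poly A}) : theta (X + Y) = theta X + theta Y.
Proof. by rewrite /theta derivD mulrDr. Qed.

Lemma theta_Xn (A : comNzRingType) (c : A) n :
  theta (c%:P * 'X^n) = c%:P * 'X^n *+ n.
Proof.
rewrite /theta derivM derivC mul0r add0r derivXn mulrCA.
by case: n => [|n]; rewrite ?mulr0n ?mulr0 // mulrnAr -exprS mulrnAr.
Qed.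

Section ShiftedDerivations.
Variables (R A : comNzRingType) (I : Type) (x : I -> R) (const : R -> Prop).
Hypothesis R_ind : forall P : R -> Prop,
  (forall a, const a -> P a) -> (forall f g, P f -> P g -> P (f + g)) ->
  (forall i f, P f -> P (x i * f)) -> forall f, P f.
Variables (phi : {rmorphism R -> {poly A}}).
Variables (dR : nat -> {additive R -> R}) (d : nat -> {additive A -> A}).
Hypothesis dRM : forall k f g, dR k (f * g) = dR k f * g + f * dR k g.
Hypothesis dM : forall k f g, d k (f * g) = d k f * g + f * d k g.
Hypothesis dR_const : forall k a, const a -> dR k a = 0.
Hypothesis phi_const : forall a, const a -> exists2 b, phi a = b%:P & forall k, d k b = 0.

Let phi_const_der k a : const a -> map_poly (d k) (phi a) = 0.
Proof. by move=> /phi_const[b -> db]; rewrite map_polyC db. Qed.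

Lemma shifted_der k f : (forall i, phi (dR k (x i)) = map_poly (d k) (phi (x i))) ->
  phi (dR k f) = map_poly (d k) (phi f).
Proof.
move=> phi_x; elim/R_ind: f => [a c_a|f g IHf IHg|i f IHf].
- by rewrite dR_const // phi_const_der // raddf0.
- by rewrite !raddfD /= IHf IHg.
- by rewrite dRM rmorphD !rmorphM /= phi_x IHf map_derM.
Qed.

Lemma shifted_der_eq0 k f : (forall i, map_poly (d k) (phi (x i)) = 0) ->
  map_poly (d k) (phi f) = 0.
Proof.
move=> phi_x; elim/R_ind: f => [a c_a|f g IHf IHg|i f IHf].
- exact: phi_const_der.
- by rewrite !raddfD /= IHf IHg addr0.
- by rewrite rmorphM /= map_derM // phi_x IHf mulr0 mul0r addr0.
Qed.

(** Chain rule: [phi] introduces z only through shifts p_k + c z^k. Both sides obey the Leibniz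
    rule, so generators suffice. The bound is existential during the induction because the sums for
    two arguments must be brought to a common length. *)
Lemma shifted_theta (c : A) :
    (forall i, exists N0, forall N, (N0 <= N)%N ->
       theta (phi (x i)) = c *: \sum_(k < N) 'X^k * map_poly (d k) (phi (x i))) ->
  forall f N, (forall k, (N <= k)%N -> map_poly (d k) (phi f) = 0) ->
  theta (phi f) = c *: \sum_(k < N) 'X^k * map_poly (d k) (phi f).
Proof.
move=> phi_x f N df0.
have [N0 hN0] : exists N0, forall N1, (N0 <= N1)%N ->
  theta (phi f) = c *: \sum_(k < N1) 'X^k * map_poly (d k) (phi f).
  elim/R_ind: f {N df0} => [a c_a|f g [Nf IHf] [Ng IHg]|i f [Nf IHf]].
  - exists 0%N => N1 _; rewrite big1 => [|k _]; last by rewrite phi_const_der ?mulr0.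
    by have [b -> _] := phi_const c_a; rewrite theta_polyC scaler0.
  - exists (maxn Nf Ng) => N1; rewrite geq_max => /andP[leNf leNg].
    rewrite rmorphD thetaD /= (IHf _ leNf) (IHg _ leNg) -scalerDr -big_split.
    by congr (_ *: _); apply: eq_bigr => k _; rewrite raddfD mulrDr.
  have [Ni IHi] := phi_x i.
  exists (maxn Nf Ni) => N1; rewrite geq_max => /andP[leNf leNi].
  rewrite rmorphM theta_mul /= (IHf _ leNf) (IHi _ leNi).
  rewrite -scalerAl -scalerAr -scalerDr mulr_suml mulr_sumr -big_split.
  congr (_ *: _); apply: eq_bigr => k _ /=.
  by rewrite map_derM // mulrDr mulrA mulrCA.
rewrite (hN0 (maxn N N0)) ?leq_maxr //; congr (_ *: _).
apply: (@sum_ord_widen _ (fun k => 'X^k * map_poly (d k) (phi f))).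
  exact: leq_maxl.
by move=> k /df0; move: (map_poly _ _) => X ->; rewrite mulr0.
Qed.

End ShiftedDerivations.

(** Coefficient form of d(exp g) = d(g) exp g, where q_i is i times the i-th coefficient of g.
    Applying [d] to the recursion at [j] gives [k] times and, by induction, [j - k] times s e_(j-k);
    then [j] is cancelled. *)
Lemma der_exp_coef (A : comNzRingType) (e q : nat -> A) (d : {additive A -> A}) (k : nat) (s : A) :
    (forall n (a : A), n.+1%:R * a = 0 -> a = 0) ->
    (forall f g, d (f * g) = d f * g + f * d g) ->
    q 0%N = 0 -> d (e 0%N) = 0 -> (0 < k)%N ->
    (forall i, d (q i) = if i == k then s * k%:R else 0) ->
    (forall j, j%:R * e j = \sum_(i < j.+1) q i * e (j - i)%N) ->
  forall j, d (e j) = if (k <= j)%N then s * e (j - k)%N else 0.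
Proof.
move=> torsion_free dM q0 de0 k0 dq e_rec j.
have [n] := ubnP j; elim: n => // n IHn in j *; rewrite ltnS => le_jn.
case: j le_jn => [|j] le_jn; first by rewrite de0 leqNgt k0.
apply/eqP; rewrite -subr_eq0; apply/eqP; apply: (@torsion_free j).
have de_nat (m : nat) (f : A) : d (m%:R * f) = m%:R * d f by rewrite !mulr_natl raddfMn.
rewrite mulrBr -de_nat e_rec raddf_sum.
under eq_bigr => i _ do rewrite dM dq.
rewrite big_split /= [X in _ + X - _]big_ord_recl q0 mul0r add0r.
have -> : \sum_(i < j.+2) (if i == k :> nat then s * k%:R else 0) * e (j.+1 - i)%N
    = if (k <= j.+1)%N then k%:R * (s * e (j.+1 - k)%N) else 0.
  case: ifP => [le_kj|gt_kj]; last first.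
    rewrite big1 // => i _; case: eqP => [ik|_]; last by rewrite mul0r.
    by move: gt_kj; rewrite -ik -ltnS ltn_ord.
  rewrite (bigD1 (Ordinal (le_kj : (k < j.+2)%N))) //= eqxx big1 ?addr0.
    by rewrite mulrCA mulrA.
  by move=> i /negPf; rewrite -val_eqE /= => ->; rewrite mul0r.
have -> : \sum_(i < j.+1) q (lift ord0 i) * d (e (j.+1 - lift ord0 i)%N)
    = if (k <= j.+1)%N then s * ((j.+1 - k)%:R * e (j.+1 - k)%N) else 0.
  transitivity (\sum_(i < j.+2) if (i + k <= j.+1)%N then s * (q i * e (j.+1 - k - i)%N) else 0).
    rewrite [RHS]big_ord_recl q0 mul0r mulr0 if_same add0r; apply: eq_bigr => i _.
    rewrite IHn; last first.
      by rewrite lift0 subSS (leq_ltn_trans (leq_subr _ _)) // (leq_trans _ le_jn).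
    rewrite leq_subRL; last by rewrite -ltnS ltn_ord.
    by case: ifP => _; rewrite ?mulr0 // mulrCA subnAC.
  case: ifP => [le_kj|gt_kj]; last first.
    rewrite big1 // => i _; case: ifP => // /(leq_trans (leq_addl _ _)).
    by rewrite gt_kj.
  rewrite e_rec mulr_sumr.
  pose h i := s * (q i * e (j.+1 - k - i)%N).
  rewrite (big_ord_widen j.+2 h); last by rewrite ltnS leq_subr.
  rewrite [RHS]big_mkcond; apply: eq_bigr => i _ /=.
  by rewrite ltnS leq_subRL // addnC.
case: ifP => [le_kj|]; last by rewrite addr0 mulr0 subrr.
by rewrite [X in _ + X - _]mulrCA -mulrDl -natrD subnKC // subrr.
Qed.

Lemma residueE (A : comNzRingType) (e : nat -> A) (g : {poly A}) :
  residue e g = bracket e 1 g.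
Proof.
rewrite (@bracketE _ _ (size g).+1) // big_ord_recl mulr0 add0r.
by apply: eq_bigr => i _; rewrite lift0 subSS subn0 mulrC.
Qed.

(** * The polynomial rings in one and in two sets of KP variables *)

Section Instance.
Variable T : choiceType.

Local Notation R := (mpolyQ (one_set T)).
Local Notation A := (mpolyQ (two_sets T)).

Definition one_idx (i : nat) : one_set T := inr i.
Definition fst_idx (i : nat) : two_sets T := inr (inl i).
Definition snd_idx (i : nat) : two_sets T := inr (inr i).

Definition one_rank (j : one_set T) : nat := if j is inr i then i.+1 else 0%N.
Definition fst_rank (j : two_sets T) : nat := if j is inr (inl i) then i.+1 else 0%N.
Definition snd_rank (j : two_sets T) : nat := if j is inr (inr i) then i.+1 else 0%N.

Let e : nat -> A := series_exp (hirota_exponent T).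

Let torsion_free n (a : A) : n.+1%:R * a = 0 -> a = 0.
Proof.
move=> na0; rewrite -[a]scale1r -(@mulVf _ (n.+1%:R : rat)) ?pnatr_eq0 //.
by rewrite -scalerA scaler_nat -[a *+ _]mulr_natl na0 scaler0.
Qed.

Let e_rec j : j%:R * e j = \sum_(k < j.+1) (pvar fst_idx k - pvar snd_idx k) * e (j - k)%N.
Proof.
have := @series_exp_rec A (hirota_exponent T) erefl j.
rewrite -/e => ->.
apply: eq_bigr => k _.
have -> : k%:R * hirota_exponent T k = pvar fst_idx k - pvar snd_idx k.
  case: (nat_of_ord k) => [|i]; first by rewrite mul0r !pvar0 subrr.
  rewrite /= mulr_natl -scaler_nat scalerA mulfV ?pnatr_eq0 //.
  by rewrite scale1r !pvarS.
by [].
Qed.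

Let e0 : e 0%N = 1.
Proof. by rewrite /e /series_exp big_ord1 fact0 invr1 scale1r. Qed.

Let pder_pvar (x y : nat -> two_sets T) k i :
  pder x k (pvar y i.+1) = (x k.-1 == y i)%:R *+ k.
Proof. by rewrite pvarS pderX. Qed.

Let pder1 (x : nat -> two_sets T) k : pder x k 1 = 0.
Proof. by rewrite -mpolyC1E pderC. Qed.

Lemma pder_fst_exp k j : (0 < k)%N ->
  pder fst_idx k (e j) = if (k <= j)%N then e (j - k)%N else 0.
Proof.
move=> k0.
rewrite (@der_exp_coef A e (fun i => pvar fst_idx i - pvar snd_idx i) _ k 1) //.
- by rewrite mul1r.
- exact: pderM.
- by rewrite !pvar0 subrr.
- by rewrite e0; apply: pder1.
move=> [|i]; first by rewrite !pvar0 subrr raddf0 eq_sym gtn_eqF.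
case: k k0 => // k _; rewrite raddfB /= !pder_pvar mul0rn subr0.
have -> : (fst_idx k == fst_idx i) = (i.+1 == k.+1) by rewrite eqSS eq_sym.
by case: eqP; rewrite ?mul0rn ?mul1r.
Qed.

Lemma pder_snd_exp k j : (0 < k)%N ->
  pder snd_idx k (e j) = if (k <= j)%N then - e (j - k)%N else 0.
Proof.
move=> k0.
rewrite (@der_exp_coef A e (fun i => pvar fst_idx i - pvar snd_idx i) _ k (-1)) //.
- by rewrite mulN1r.
- exact: pderM.
- by rewrite !pvar0 subrr.
- by rewrite e0; apply: pder1.
move=> [|i]; first by rewrite !pvar0 subrr raddf0 eq_sym gtn_eqF.
case: k k0 => // k _; rewrite raddfB /= !pder_pvar mul0rn sub0r.
have -> : (snd_idx k == snd_idx i) = (i.+1 == k.+1) by rewrite eqSS eq_sym.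
by case: eqP; rewrite ?mul0rn ?oppr0 ?mulN1r.
Qed.

Let const (f : R) := exists q : rat, f = q%:MP.

Let R_ind (P : R -> Prop) :
  (forall a, const a -> P a) -> (forall f g, P f -> P g -> P (f + g)) ->
  (forall i f, P f -> P (mvar i * f)) -> forall f, P f.
Proof. by move=> PC PD PX; apply: mpoly_ind => // q; apply: PC; exists q. Qed.

Let const_pder k a : const a -> pder one_idx k a = 0.
Proof. by case=> q ->; apply: pderC. Qed.

Let const_mcompose (sh : one_set T -> {poly A}) (x : nat -> two_sets T) a :
  const a -> exists2 b, mcompose sh a = b%:P & forall k, pder x k b = 0.
Proof. by case=> q ->; exists q%:MP; [apply: mcomposeC | move=> k; apply: pderC]. Qed.

(** A common form of both shifts, so that their compatibility with the derivations and with theta is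
    proved once. *)
Let sign_shift (s : bool) (x : nat -> two_sets T) (j : one_set T) : {poly A} :=
  match j with
  | inl t => (mvar (inl t : two_sets T))%:P
  | inr i => (mvar (x i))%:P + (-1) ^+ s *: 'X^(i.+1)
  end.

Let minus_shiftE : @minus_shift T =1 sign_shift true fst_idx.
Proof. by case=> [t|i] //=; rewrite expr1 scaleN1r. Qed.

Let plus_shiftE : @plus_shift T =1 sign_shift false snd_idx.
Proof. by case=> [t|i] //=; rewrite expr0 scale1r. Qed.

Section Generators.
Variables (s : bool) (x : nat -> two_sets T).
Hypothesis x_inl : forall i t, (x i == inl t) = false.

Let map_monom (y : nat -> two_sets T) k n :
  map_poly (pder y k) ((-1) ^+ s *: 'X^n) = 0.
Proof.
apply/polyP => i; rewrite coef_map coefZ coefXn coef0 /=.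
case: (i == n); last by rewrite mulr0 raddf0.
by rewrite mulr1; case: s; rewrite ?expr0 ?expr1 ?raddfN /= pder1 ?oppr0.
Qed.

Let pder_inl k t : pder x k (mvar (inl t : two_sets T)) = 0.
Proof. by rewrite pderX x_inl mul0rn. Qed.

Lemma sign_shift_pder k j : (forall i i', (x i == x i') = (i == i')) ->
  mcompose (sign_shift s x) (pder one_idx k (mvar j))
  = map_poly (pder x k) (mcompose (sign_shift s x) (mvar j)).
Proof.
move=> x_inj; rewrite mcomposeX pderX; case: j => [t|i] /=.
  by rewrite map_polyC /= pder_inl mul0rn raddf0.
rewrite raddfD /= map_polyC map_monom addr0 /= pderX x_inj.
have -> : (one_idx k.-1 == inr i) = (k.-1 == i) by [].
by rewrite rmorphMn rmorph_nat polyCMn polyC_natr.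
Qed.

Lemma sign_shift_pder0 (y : nat -> two_sets T) k j :
    (forall i i', (y i == x i') = false) -> (forall i t, (y i == inl t) = false) ->
  map_poly (pder y k) (mcompose (sign_shift s x) (mvar j)) = 0.
Proof.
move=> yx y_inl; rewrite mcomposeX; case: j => [t|i] /=.
  by rewrite map_polyC /= pderX y_inl mul0rn.
by rewrite raddfD /= map_polyC map_monom addr0 /= pderX yx mul0rn.
Qed.

Lemma sign_shift_theta j : (forall i i', (x i == x i') = (i == i')) ->
  exists N0, forall N, (N0 <= N)%N ->
  theta (mcompose (sign_shift s x) (mvar j)) = (-1) ^+ s *:
    \sum_(k < N) 'X^k * map_poly (pder x k) (mcompose (sign_shift s x) (mvar j)).
Proof.
move=> x_inj; rewrite mcomposeX; case: j => [t|i] /=.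
  exists 0%N => N _; rewrite theta_polyC big1 ?scaler0 // => k _.
  by rewrite map_polyC /= pder_inl mulr0.
exists i.+2 => N lt_iN; rewrite thetaD theta_polyC add0r.
rewrite (bigD1 (Ordinal lt_iN)) //= big1 ?addr0 => [|k ne_ki].
  rewrite raddfD /= map_polyC map_monom addr0 /= pderX eqxx.
  rewrite -mul_polyC theta_Xn mul_polyC polyCMn mulrnAr mulr1.
  by rewrite scalerMnr.
rewrite raddfD /= map_polyC map_monom addr0 /= pderX x_inj.
case: eqP => [ki|_]; last by rewrite mul0rn mulr0.
(* Since [0.-1] is 0, the term k = 0 also refers to p_1; it disappears thanks to the factor k in
   [pder]. *)
case: k ne_ki ki => [[|k] lt_k] /=; first by rewrite mulr0n mulr0.
by move=> /eqP ne_ki ki; case: ne_ki; apply: val_inj; rewrite /= ki.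
Qed.

End Generators.

Let fst_inl i t : (fst_idx i == inl t) = false. Proof. by []. Qed.
Let snd_inl i t : (snd_idx i == inl t) = false. Proof. by []. Qed.
Let fst_inj i j : (fst_idx i == fst_idx j) = (i == j). Proof. by []. Qed.
Let snd_inj i j : (snd_idx i == snd_idx j) = (i == j). Proof. by []. Qed.

Let minus : {rmorphism R -> {poly A}} := mcompose (sign_shift true fst_idx).
Let plus : {rmorphism R -> {poly A}} := mcompose (sign_shift false snd_idx).

Let minus_d k f : minus (pder one_idx k f) = map_poly (pder fst_idx k) (minus f).
Proof.
apply: (shifted_der R_ind (pderM one_idx) (pderM fst_idx) const_pder) => // [a|j].
  exact: const_mcompose.
exact: sign_shift_pder.
Qed.

Let plus_d k f : plus (pder one_idx k f) = map_poly (pder snd_idx k) (plus f).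
Proof.
apply: (shifted_der R_ind (pderM one_idx) (pderM snd_idx) const_pder) => // [a|j].
  exact: const_mcompose.
exact: sign_shift_pder.
Qed.

Let minus_d' k f : map_poly (pder snd_idx k) (minus f) = 0.
Proof.
apply: (shifted_der_eq0 R_ind (pderM snd_idx)) => [a|j]; first exact: const_mcompose.
exact: sign_shift_pder0.
Qed.

Let plus_d' k f : map_poly (pder fst_idx k) (plus f) = 0.
Proof.
apply: (shifted_der_eq0 R_ind (pderM fst_idx)) => [a|j]; first exact: const_mcompose.
exact: sign_shift_pder0.
Qed.

Let one_bound f k : (var_bound one_rank f <= k)%N -> pder one_idx k f = 0.
Proof. exact: pder_bound. Qed.

Let minus_theta N f : (var_bound one_rank f <= N)%N ->
  theta (minus f) = - \sum_(k < N) 'X^k * map_poly (pder fst_idx k) (minus f).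
Proof.
move=> leN; have df0 k : (N <= k)%N -> map_poly (pder fst_idx k) (minus f) = 0.
  move=> leNk; rewrite -minus_d one_bound ?raddf0 //; exact: leq_trans leNk.
have phi_x j := sign_shift_theta true fst_inl j fst_inj.
rewrite (shifted_theta R_ind (pderM fst_idx) (const_mcompose _ _) phi_x df0).
by rewrite expr1 scaleN1r.
Qed.

Let plus_theta N f : (var_bound one_rank f <= N)%N ->
  theta (plus f) = \sum_(k < N) 'X^k * map_poly (pder snd_idx k) (plus f).
Proof.
move=> leN; have df0 k : (N <= k)%N -> map_poly (pder snd_idx k) (plus f) = 0.
  move=> leNk; rewrite -plus_d one_bound ?raddf0 //; exact: leq_trans leNk.
have phi_x j := sign_shift_theta false snd_inl j snd_inj.
rewrite (shifted_theta R_ind (pderM snd_idx) (const_mcompose _ _) phi_x df0).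
by rewrite expr0 scale1r.
Qed.

Let minus_p k : minus (pvar one_idx k) =
  (pvar fst_idx k)%:P - (if (0 < k)%N then 'X^k else 0).
Proof.
case: k => [|k]; first by rewrite !pvar0 raddf0 subrr.
by rewrite !pvarS /minus /plus /= mcomposeX /= expr1 scaleN1r.
Qed.

Let plus_p k : plus (pvar one_idx k) =
  (pvar snd_idx k)%:P + (if (0 < k)%N then 'X^k else 0).
Proof.
case: k => [|k]; first by rewrite !pvar0 raddf0 addr0.
by rewrite !pvarS /minus /plus /= mcomposeX /= expr0 scale1r.
Qed.

Definition KP_evolution : R -> R -> R -> R :=
  evolution (pvar one_idx) (pder one_idx) (var_bound one_rank).

(** The four substitution hypotheses express that [c1] and [c2] are made of parameters only: neither
    shift introduces zeta, and both give the same constant. *)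
Theorem KP_tau_evolution (c1 c2 : R) (c1' c2' : A) (Z : nat -> R) :
    msubst (@minus_shift T) c1 = c1'%:P -> msubst (@plus_shift T) c1 = c1'%:P ->
    msubst (@minus_shift T) c2 = c2'%:P -> msubst (@plus_shift T) c2 = c2'%:P ->
    Z 0%N = 1 ->
    (forall n, Z n.+1 *+ (4 * n.+1) = KP_evolution c1 c2 (Z n)) ->
  KP_tau Z.
Proof.
have minusE f : msubst (@minus_shift T) f = minus f.
  have -> : msubst (@minus_shift T) f = mcompose (@minus_shift T) f.
    by rewrite mcompose.unlock.
  by apply: eq_mcompose => c i _ _; apply: minus_shiftE.
have plusE f : msubst (@plus_shift T) f = plus f.
  have -> : msubst (@plus_shift T) f = mcompose (@plus_shift T) f.
    by rewrite mcompose.unlock.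
  by apply: eq_mcompose => c i _ _; apply: plus_shiftE.
rewrite !minusE !plusE => m1 p1 m2 p2 Z0 Z_rec n.
have := @hirota_bilinear R A (pvar one_idx) (pder one_idx) (var_bound one_rank)
  (pvar fst_idx) (pvar snd_idx) (pder fst_idx) (pder snd_idx)
  (var_bound fst_rank) (var_bound snd_rank) e minus plus.
move/(_ (pder_comm _ _) one_bound (pder_comm _ _) (fun f k => @pder_bound _ fst_idx fst_rank (frefl _) f k)).
move/(_ (pder_comm _ _) (fun f k => @pder_bound _ snd_idx snd_rank (frefl _) f k)).
move/(_ (pvar0 _) (pder0 _) (pvar0 _) (pder0 _) (pderM _) (pderM _)).
move/(_ (fun k j => pder_fst_exp j) (fun k j => pder_snd_exp j) e_rec minus_p plus_p).
move/(_ minus_d plus_d minus_d' plus_d' minus_theta plus_theta).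
move/(_ _ _ _ _ m1 p1 m2 p2 torsion_free Z Z0 Z_rec n) => bil0.
rewrite residueE -/e.
have -> : series_mul (fun a => msubst (@minus_shift T) (Z a))
    (fun b => msubst (@plus_shift T) (Z b)) n
    = \sum_(a < n.+1) minus (Z a) * plus (Z (n - a)%N).
  by apply: eq_bigr => a _; rewrite minusE plusE.
by rewrite raddf_sum.
Qed.

End Instance.

(** * Cycle types and transpositions *)

Section CycleWeight.
Variables (R : comNzRingType) (g : nat -> R).

(** With [g] the power sums this is the cycle type of [s]; with [g] constant equal to u it is u to
    the number of cycles. *)
Definition cycle_weight (T : finType) (s : {perm T}) : R :=
  \prod_(C in porbits s) g #|C|.

End CycleWeight.

Section Orbits.
Variable T : finType.
Implicit Types (s t : {perm T}) (x y z : T) (C D S : {set T}).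

Lemma porbit_agree s t S x : {in S, s =1 t} -> porbit s x \subset S ->
  porbit t x = porbit s x.
Proof.
move=> st sS; have sxt i : (t ^+ i)%g x = (s ^+ i)%g x.
  elim: i => [|i IHi]; first by rewrite !expg0 !perm1.
  by rewrite !expgSr !permM IHi st // (subsetP sS) // mem_porbit.
by apply/setP => z; apply/porbitP/porbitP => -[i ->]; exists i; rewrite sxt.
Qed.

Lemma porbits_eqE s C x : C \in porbits s -> (porbit s x == C) = (x \in C).
Proof. by case/imsetP => y _ ->; rewrite eq_porbit_mem. Qed.

Lemma porbit_in_porbits s x : porbit s x \in porbits s.
Proof. exact: imset_f. Qed.

Lemma sum_porbit (V : nmodType) s (F : {set T} -> V) :
  \sum_x F (porbit s x) = \sum_(C in porbits s) F C *+ #|C|.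
Proof.
rewrite (partition_big (porbit s) (mem (porbits s))) => [|x _]; last first.
  exact: porbit_in_porbits.
apply: eq_bigr => C sC; rewrite -sumr_const.
rewrite (eq_bigl (mem C)) => [|x]; last by rewrite /= porbits_eqE.
by apply: eq_bigr => x Cx; congr F; apply/eqP; rewrite porbits_eqE.
Qed.

Lemma porbit_iter_inj s x i j :
    (i < #|porbit s x|)%N -> (j < #|porbit s x|)%N ->
  (iter i s x == iter j s x) = (i == j).
Proof.
move=> lti ltj; rewrite -(nth_traject _ lti) -(nth_traject _ ltj).
by rewrite nth_uniq ?size_traject ?uniq_traject_porbit.
Qed.

Lemma sum_in_porbit (V : nmodType) s x (F : T -> V) :
  \sum_(y in porbit s x) F y = \sum_(k < #|porbit s x|) F (iter k s x).
Proof.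
rewrite (eq_bigl (mem (traject s x #|porbit s x|))); last exact: porbit_traject.
rewrite -big_uniq ?uniq_traject_porbit //= (big_nth x) big_mkord size_traject.
by apply: eq_bigr => i _; rewrite nth_traject.
Qed.

(** Meant for [t] a transposition times [s]: it follows [s] along an arc and then jumps back to the
    start, so this arc is a whole cycle of [t]. *)
Lemma porbit_shortcut s t z m :
    (0 < m <= #|porbit s z|)%N ->
    (forall i, (i.+1 < m)%N -> t (iter i s z) = iter i.+1 s z) ->
    t (iter m.-1 s z) = z ->
  porbit t z =i traject s z m /\ #|porbit t z| = m.
Proof.
case: m => // m /= ltm st_i t_last.
have tsE i : (i <= m)%N -> iter i t z = iter i s z.
  elim: i => [|i IHi] lt_im; first by [].
  by rewrite iterS (IHi (ltnW lt_im)) st_i.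
have trE : traject t z m.+1 = traject s z m.+1.
  apply: (@eq_from_nth _ z); rewrite ?size_traject // => i lt_im.
  by rewrite !nth_traject // tsE.
have utr : uniq (traject s z m.+1).
  by have := uniq_traject_porbit s z; rewrite -(cat_take_drop m.+1 (traject _ _ _))
    cat_uniq take_traject // => /andP[].
have orbE : porbit t z =i traject s z m.+1.
  move=> y; rewrite -trE; apply/idP/idP => [/porbitP[i ->]|/trajectP[i _ ->]].
    rewrite permX; apply/loopingP: i.
    by rewrite /looping iterS tsE // t_last trE mem_head.
  by rewrite -permX mem_porbit.
by split=> //; rewrite (eq_card orbE) (card_uniqP utr) size_traject.
Qed.

Lemma porbit_app s x : porbit s (s x) = porbit s x.
Proof. by have := porbit_perm s 1 x; rewrite expg1. Qed.

Lemma porbit_iter s x i : porbit s (iter i s x) = porbit s x.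
Proof. by rewrite -permX porbit_perm. Qed.

Section Cut.
Variables (s : {perm T}) (x : T) (k : nat).
Hypothesis k_range : (0 < k < #|porbit s x|)%N.

Local Notation C := (porbit s x).
Local Notation y := (iter k s x).
Local Notation t := (tperm x y * s)%g.

Let tx : t x = s y. Proof. by rewrite permM tpermL. Qed.
Let ty : t y = s x. Proof. by rewrite permM tpermR. Qed.

Let t_iter i : (0 < i < #|C|)%N -> i != k -> t (iter i s x) = iter i.+1 s x.
Proof.
case/andP=> i0 lti ne_ik; have [k0 ltk] := andP k_range.
have C0 : (0 < #|C|)%N by apply: leq_trans lti.
rewrite permM tpermD //; first by rewrite -[x]/(iter 0 s x) porbit_iter_inj // ltn_eqF.
by rewrite porbit_iter_inj // eq_sym.
Qed.

(** As [t y = s x], the cycle of [y] under [t] reads s x, ..., s^k x = y. Dually, the cycle of [x]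
    starts from [t x = s y] and closes up after the remaining points. *)
Let cut_y : porbit t y =i traject s (s x) k /\ #|porbit t y| = k.
Proof.
have [k0 ltk] := andP k_range.
have := @porbit_shortcut s t (s x) k.
rewrite porbit_app -ty porbit_app ty; apply.
- by rewrite k0 ltnW.
- move=> i lt_ik; rewrite -!iterSr t_iter //; last by rewrite ltn_eqF.
  by rewrite (ltn_trans lt_ik).
by rewrite -iterSr prednK // ty.
Qed.

Let cut_x : porbit t x =i traject s (s y) (#|C| - k) /\ #|porbit t x| = (#|C| - k)%N.
Proof.
have [k0 ltk] := andP k_range.
have := @porbit_shortcut s t (s y) (#|C| - k).
rewrite porbit_app porbit_iter -tx porbit_app tx; apply.
- by rewrite subn_gt0 ltk leq_subr.
- move=> i lt_i; rewrite -!iterS -iterSr -!iterD t_iter ?addnS //; last by lia.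
  by rewrite addSn /=; lia.
rewrite -iterSr -iterD prednK ?subn_gt0 // subnK 1?ltnW //.
by rewrite iter_porbit tx.
Qed.

(** The two non-memberships make the unions disjoint, so that a product over the cycles of [t]
    splits off its two new factors. *)
Lemma porbits_cut :
  [/\ porbits t = porbit t x |: (porbit t y |: porbits s :\ C),
      porbit t y \notin porbits s :\ C,
      porbit t x \notin porbit t y |: porbits s :\ C,
      #|porbit t x| = (#|C| - k)%N & #|porbit t y| = k].
Proof.
have [k0 ltk] := andP k_range; have [[txE card_tx] [tyE card_ty]] := (cut_x, cut_y).
have yC : y \in C by rewrite -permX mem_porbit.
have orb_out z : z \notin C -> porbit t z = porbit s z.
  move=> zC; apply: (@porbit_agree s t (porbit s z)) => // u zu.
  rewrite permM tpermD //; apply: contraNneq zC => eq_u; rewrite porbit_sym.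
    by rewrite eq_u.
  by rewrite -eq_porbit_mem -(porbit_iter s x k) eq_porbit_mem eq_u.
have notin_D z : z \in C -> porbit t z \notin porbits s :\ C.
  move=> zC; rewrite in_setD1 negb_and negbK orbC -implybE; apply/implyP => zs.
  have [] := (porbits_eqE z zs, porbits_eqE x zs).
  rewrite porbit_id => /eqP <- _; by rewrite eq_porbit_mem.
split=> //.
- apply/setP => D; rewrite !inE; apply/imsetP/idP => [[z _ ->]|].
    have [zC|zC] := boolP (z \in C); last first.
      rewrite orb_out // porbit_in_porbits andbT.
      by rewrite [porbit s z == C]eq_porbit_mem zC !orbT.
    have := zC; rewrite porbit_traject => /trajectP[j ltj eq_z].
    have [j0|j_gt0] := posnP j; first by rewrite eq_z j0 eqxx.
    have [le_jk|lt_kj] := leqP j k.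
      suff /eqP-> : porbit t z == porbit t y by rewrite eqxx orbT.
      rewrite eq_porbit_mem tyE; apply/trajectP; exists j.-1.
        by rewrite prednK.
      by rewrite -iterSr prednK.
    suff /eqP-> : porbit t z == porbit t x by rewrite eqxx.
    rewrite eq_porbit_mem txE; apply/trajectP; exists (j - k.+1)%N; first lia.
    by rewrite -iterS -iterD subnK.
  case/or3P=> [/eqP->|/eqP->|/andP[neD]]; [by exists x|by exists y|].
  case/imsetP=> z _ eqD; exists z => //; rewrite orb_out //.
  by apply: contraNN neD => zC; rewrite eqD eq_porbit_mem.
- exact: notin_D.
rewrite in_setU1 negb_or notin_D ?porbit_id // andbT eq_sym eq_porbit_mem.
rewrite txE; apply/trajectP => -[i lt_i]; rewrite -iterS -iterD => eq_y.
have [le_L|lt_L] := leqP #|C| (i + k.+1).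
  have eqL : (i + k.+1 = #|C|)%N by lia.
  move/eqP: eq_y; rewrite eqL iter_porbit eq_sym -[x in x == _]/(iter 0 s x).
  by rewrite porbit_iter_inj ?ltn_eqF // (ltn_trans k0).
by move/eqP: eq_y; rewrite porbit_iter_inj // ltn_eqF // addnS ltnS leq_addl.
Qed.

End Cut.

End Orbits.

Section Intertwine.
Variables (T T' : finType) (f : T' -> T) (s : {perm T}) (s' : {perm T'}).
Hypothesis f_inj : injective f.
Hypothesis fs : forall x, s (f x) = f (s' x).

Lemma porbit_intertwine x : porbit s (f x) = f @: porbit s' x.
Proof.
have fsX i : (s ^+ i)%g (f x) = f ((s' ^+ i)%g x).
  elim: i => [|i IHi]; first by rewrite !expg0 !perm1.
  by rewrite !expgSr !permM IHi fs.
apply/setP => y; apply/porbitP/imsetP => [[i ->]|[_ /porbitP[i ->] ->]].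
  by exists ((s' ^+ i)%g x); rewrite ?mem_porbit.
by exists i.
Qed.

Lemma porbits_intertwine :
  [set C in porbits s | C \subset codom f] = [set f @: C | C : {set T'} in porbits s'].
Proof.
apply/setP => C; rewrite inE; apply/andP/imsetP => [[/imsetP[y _ ->]]|[D]].
  move=> /subsetP/(_ y (porbit_id s y))/codomP[x ->].
  by exists (porbit s' x); rewrite ?porbit_in_porbits ?porbit_intertwine.
case/imsetP=> x _ -> ->; rewrite -porbit_intertwine porbit_in_porbits; split=> //.
rewrite porbit_intertwine; apply/subsetP => y /imsetP[z _ ->].
exact: codom_f.
Qed.

Lemma prod_porbits_intertwine (R : comNzRingType) (g : nat -> R) :
  \prod_(C in porbits s | C \subset codom f) g #|C| = cycle_weight g s'.
Proof.
transitivity (\prod_(C in [set C in porbits s | C \subset codom f]) g #|C|).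
  by apply: eq_bigl => C; rewrite inE.
rewrite porbits_intertwine big_imset /=; last first.
  by move=> C D _ _; apply: imset_inj.
by apply: eq_bigr => C _; rewrite card_imset.
Qed.

End Intertwine.

Section Weights.
Variables (R : comNzRingType) (g : nat -> R) (T : finType).
Implicit Types s t h : {perm T}.

Lemma cycle_weight_conj s h : cycle_weight g (s ^ h)%g = cycle_weight g s.
Proof.
rewrite -(@prod_porbits_intertwine _ _ h (s ^ h)%g s); first last.
- by move=> x; rewrite permJ.
- exact: perm_inj.
apply: eq_bigl => C; rewrite andb_idr // => _.
by apply/subsetP => x _; apply/codomP; exists ((h^-1)%g x); rewrite permKV.
Qed.

Lemma cycle_weight_mulC s t : cycle_weight g (s * t)%g = cycle_weight g (t * s)%g.
Proof. by rewrite -(cycle_weight_conj (s * t)%g s) conjgE !mulgA mulVg mul1g. Qed.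

Lemma cycle_weight_cut s x k : (0 < k < #|porbit s x|)%N ->
  cycle_weight g (tperm x (iter k s x) * s)%g
  = g (#|porbit s x| - k)%N * g k
    * \prod_(C in porbits s :\ porbit s x) g #|C|.
Proof.
move=> k_range; have [porbE y_notin x_notin card_x card_y] := porbits_cut k_range.
by rewrite /cycle_weight porbE !big_setU1 //= card_x card_y mulrA.
Qed.

(** Joining is undone by the same transposition, so this is the cut formula applied to [t]. *)
Lemma cycle_weight_join s x y : y \notin porbit s x ->
  cycle_weight g (tperm x y * s)%g
  = g (#|porbit s x| + #|porbit s y|)%N
    * \prod_(C in porbits s :\ porbit s x :\ porbit s y) g #|C|.
Proof.
move=> y_notin; pose t := (tperm x y * s)%g.
have ts : (tperm x y * t)%g = s by rewrite mulgA tperm2 mul1g.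
have ne_xy : x != y by apply: contraNneq y_notin => <-; apply: porbit_id.
(* The number of cycles drops by one from [s] to [t], hence rises on the way back, which forces [x]
   and [y] into one cycle of [t]. *)
have y_t : y \in porbit t x.
  have := porbits_mul_tperm t x y; have := porbits_mul_tperm s x y.
  rewrite /= ts -/t ne_xy porbit_sym y_notin [y \in _]porbit_sym.
  by case: (x \in porbit t y) => //=; lia.
move: y_t; rewrite porbit_traject => /trajectP[k ltk eq_y].
have k0 : (0 < k)%N.
  by case: k eq_y {ltk} => // eq_y; rewrite eq_y eqxx in ne_xy.
have k_range : (0 < k < #|porbit t x|)%N by rewrite k0.
have := porbits_cut k_range; rewrite -eq_y ts.
case=> porbE y_notin' x_notin' card_x card_y.
have -> : porbits s :\ porbit s x :\ porbit s y = porbits t :\ porbit t x.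
  by rewrite porbE setU1K // setU1K.
rewrite card_x card_y subnK 1?ltnW // /cycle_weight.
by rewrite (big_setD1 (porbit t x)) ?porbit_in_porbits.
Qed.

End Weights.

(** Points in distinct cycles are joined, with [#|C| * #|D|] choices for given cycles. Points in the
    same cycle cut it; each of its [#|C|] points can serve as [x], and [y] is then located by its
    distance [k]. *)
Lemma sum_tperm_weight (R : comNzRingType) (g : nat -> R) (T : finType) (s : {perm T}) :
  \sum_x \sum_(y | y != x) cycle_weight g (tperm x y * s)%g
  = \sum_(C in porbits s) \sum_(D in porbits s :\ C)
      (g (#|C| + #|D|)%N * \prod_(E in porbits s :\ C :\ D) g #|E|) *+ (#|C| * #|D|)
    + \sum_(C in porbits s)
      (\sum_(k < #|C| | (0 < k)%N) g (#|C| - k)%N * g k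
         * \prod_(E in porbits s :\ C) g #|E|) *+ #|C|.
Proof.
under eq_bigr => x _ do rewrite (bigID (fun y => y \notin porbit s x)) /=.
rewrite big_split /=; congr (_ + _).
  pose H (C D : {set T}) := g (#|C| + #|D|)%N * \prod_(E in porbits s :\ C :\ D) g #|E|.
  transitivity (\sum_x \sum_(D in porbits s :\ porbit s x) H (porbit s x) D *+ #|D|).
    apply: eq_bigr => x _.
    transitivity (\sum_(y | porbit s y != porbit s x) H (porbit s x) (porbit s y)).
      apply: eq_big => [y|y /andP[_]]; last by apply: cycle_weight_join.
      by rewrite eq_porbit_mem andb_idl //; apply: contraNneq => ->; apply: porbit_id.
    transitivity (\sum_y if porbit s y != porbit s x then H (porbit s x) (porbit s y) else 0).
      by rewrite big_mkcond.
    rewrite (@sum_porbit _ _ _ (fun D => if D != porbit s x then H (porbit s x) D else 0)).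
    rewrite [RHS](eq_bigl (fun D => (D \in porbits s) && (D != porbit s x))); last first.
      by move=> D; rewrite !inE andbC.
    by rewrite big_mkcondr; apply: eq_bigr => D _; case: ifP => // _; rewrite mul0rn.
  rewrite (@sum_porbit _ _ _ (fun C => \sum_(D in porbits s :\ C) H C D *+ #|D|)).
  apply: eq_bigr => C _; rewrite -sumrMnl; apply: eq_bigr => D _.
  by rewrite -mulrnA mulnC.
pose H (C : {set T}) := \sum_(k < #|C| | (0 < k)%N) g (#|C| - k)%N * g k
         * \prod_(E in porbits s :\ C) g #|E|.
rewrite -(@sum_porbit _ _ _ H); apply: eq_bigr => x _.
transitivity (\sum_(y in porbit s x) if y != x then cycle_weight g (tperm x y * s)%g else 0).
  rewrite -big_mkcondr; apply: eq_bigl => y; rewrite negbK andbC //.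
rewrite sum_in_porbit /H [RHS]big_mkcond; apply: eq_bigr => k _.
have k_x : (iter k s x != x) = (0 < k)%N.
  rewrite -[x in _ != x]/(iter 0 s x) porbit_iter_inj // ?lt0n //.
  by rewrite card_porbit_neq0.
rewrite k_x; case: ifP => // k0; apply: cycle_weight_cut.
by rewrite k0 ltn_ord.
Qed.

(** * Cut-and-join acts on cycle types as the sum over transpositions *)

Section CutJoinWeight.
Variables (R : comNzRingType) (p : nat -> R) (d : nat -> {additive R -> R}).
Variable bound : R -> nat.
Hypothesis p0 : p 0%N = 0.
Hypothesis dM : forall k f g, d k (f * g) = d k f * g + f * d k g.
Hypothesis dp : forall i j, d i (p j) = i%:R *+ (i == j).
Hypothesis d_comm : forall i j f, d i (d j f) = d j (d i f).
Hypothesis d_bound : forall f k, (bound f <= k)%N -> d k f = 0.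

Lemma der_natr k n : d k n%:R = 0.
Proof.
suff d1 : d k 1 = 0 by rewrite raddfMn /= d1 mul0rn.
by apply: (@addrI _ (d k 1)); rewrite addr0 -{3}[1]mulr1 dM mulr1 mul1r.
Qed.

Section Product.
Variables (I : finType) (n : I -> nat).

Lemma der_prod i (A : {set I}) :
  d i (\prod_(c in A) p (n c))
  = \sum_(c in A) (\prod_(b in A :\ c) p (n b)) *+ (i * (i == n c)).
Proof.
have [m] := ubnP #|A|; elim: m => // m IHm in A *; rewrite ltnS => leAm.
have [->|[a aA]] := set_0Vmem A; first by rewrite !big_set0 (der_natr i 1).
rewrite (big_setD1 a aA) (big_setD1 a aA) /= dM dp IHm; last first.
  by move: leAm; rewrite (cardsD1 a) aA.
congr (_ + _); first by rewrite -mulrnA -mulr_natl.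
rewrite mulr_sumr; apply: eq_bigr => c; rewrite !inE => /andP[ne_ca cA].
rewrite mulrnAr; congr (_ *+ _).
rewrite (big_setD1 a (A := A :\ c)) ?inE ?aA ?andbT 1?eq_sym //=.
by congr (_ * _); apply: eq_bigl => b; rewrite !inE andbCA.
Qed.

(** Brings the operator to the shape of [sum_tperm_weight]: p_(i+j) d_i d_j replaces two factors by
    one, p_i p_j d_(i+j) replaces one by two, and the factors of d_k = k d/dp_k count the points. *)
Lemma cutjoin_prod (A : {set I}) :
  cutjoin p d bound (\prod_(c in A) p (n c))
  = \sum_(c in A) \sum_(b in A :\ c)
      (p (n c + n b)%N * \prod_(a in A :\ c :\ b) p (n a)) *+ (n c * n b)
    + \sum_(c in A)
      (\sum_(k < n c | (0 < k)%N) p (n c - k)%N * p k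
         * \prod_(a in A :\ c) p (n a)) *+ n c.
Proof.
pose N := (\max_(c in A) n c).+1.
have ltN c : c \in A -> (n c < N)%N.
  by move=> cA; rewrite ltnS; apply: leq_bigmax_cond.
have der0 k : (N <= k)%N -> d k (\prod_(c in A) p (n c)) = 0.
  move=> leNk; rewrite der_prod big1 // => c /ltN ltc.
  by rewrite gtn_eqF ?muln0 // (leq_trans ltc).
rewrite (cutjoinE _ d_comm d_bound der0) /cutjoin_upto.
transitivity (\sum_(i < N) \sum_(j < N) p (i + j)%N * d i (d j (\prod_(c in A) p (n c)))
  + \sum_(i < N) \sum_(j < N) p i * p j * d (i + j)%N (\prod_(c in A) p (n c))).
  by rewrite -big_split; apply: eq_bigr => i _; rewrite -big_split.
congr (_ + _).
  transitivity (\sum_(i < N) \sum_(j < N) \sum_(c in A) \sum_(b in A :\ c)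
     (p (i + j)%N * \prod_(a in A :\ c :\ b) p (n a)) *+ (i * (i == n b :> nat) * (j * (j == n c :> nat)))).
    apply: eq_bigr => i _; apply: eq_bigr => j _; rewrite der_prod raddf_sum mulr_sumr.
    apply: eq_bigr => c _; rewrite raddfMn /= der_prod -sumrMnl mulr_sumr.
    by apply: eq_bigr => b _; rewrite -mulrnA mulrnAr.
  under eq_bigr => i _ do rewrite exchange_big.
  rewrite exchange_big; apply: eq_bigr => c cA /=.
  under eq_bigr => i _ do rewrite exchange_big.
  rewrite exchange_big; apply: eq_bigr => b /=; rewrite inE => /andP[_ bA].
  move: (\prod_(a in _) _) => P.
  rewrite (bigD1 (Ordinal (ltN b bA))) //= [X in _ + X]big1 ?addr0 => [|i ne_i]; last first.
    apply: big1 => j _; rewrite (_ : (_ == n b) = false) ?muln0 ?mul0n //.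
    by apply: contraNF ne_i => /eqP eq_i; apply/eqP/val_inj.
  rewrite (bigD1 (Ordinal (ltN c cA))) //= big1 ?addr0 => [|j ne_j]; last first.
    rewrite (_ : (_ == n c) = false) ?muln0 ?mul0n //.
    by apply: contraNF ne_j => /eqP eq_j; apply/eqP/val_inj.
  by rewrite !eqxx !muln1 addnC mulnC.
transitivity (\sum_(i < N) \sum_(j < N) \sum_(c in A)
   (p i * p j * \prod_(a in A :\ c) p (n a)) *+ ((i + j) * (i + j == n c)%N)).
  apply: eq_bigr => i _; apply: eq_bigr => j _; rewrite der_prod mulr_sumr.
  by apply: eq_bigr => c _; rewrite mulrnAr.
under eq_bigr => i _ do rewrite exchange_big.
rewrite exchange_big; apply: eq_bigr => c cA /=.
rewrite exchange_big -sumrMnl /=.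
set P := \prod_(a in _) _.
transitivity (\sum_(j < N) (if (j < n c)%N && (0 < j)%N then p (n c - j)%N * p j * P *+ n c else 0)).
  apply: eq_bigr => j _; case: ltnP => [ltj|gej] /=; last first.
    apply: big1 => i _; case: eqP => [eq_ij|_]; last by rewrite muln0.
    have -> : i = 0%N :> nat by lia.
    by rewrite p0 !mul0r mul0rn.
  have lt_i : (n c - j < N)%N by rewrite (leq_ltn_trans (leq_subr _ _)) ?ltN.
  rewrite (bigD1 (Ordinal lt_i)) //= big1 ?addr0 => [|i ne_i]; last first.
    rewrite (_ : (_ == n c) = false) ?muln0 //.
    by apply: contraNF ne_i => /eqP eq_i; apply/eqP/val_inj => /=; lia.
  rewrite subnK ?(ltnW ltj) // eqxx muln1; case: posnP => // ->.
  by rewrite p0 mulr0 mul0r mul0rn.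
rewrite -big_mkcond /=.
have := big_ord_widen_cond N (fun j => 0 < j)%N (fun j => p (n c - j)%N * p j * P *+ n c)
  (ltnW (ltN c cA)).
by rewrite /= => ->; apply: eq_bigl => j; rewrite andbC.
Qed.

End Product.

Lemma cutjoin_cycle_weight (T : finType) (s : {perm T}) :
  cutjoin p d bound (cycle_weight p s)
  = \sum_x \sum_(y | y != x) cycle_weight p (tperm x y * s)%g.
Proof. by rewrite sum_tperm_weight /cycle_weight cutjoin_prod. Qed.

End CutJoinWeight.

(** * The evolution equation *)

Section LiftPerm.
Variable n : nat.
Implicit Types (s w b : 'S_n) (i j x y : 'I_n).

Local Notation hat s := (lift_perm ord_max ord_max s).
Local Notation lft i := (lift (@ord_max n) i).

Lemma sum_ord_lift (V : nmodType) (F : 'I_n.+1 -> V) :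
  \sum_i F i = F ord_max + \sum_(i < n) F (lft i).
Proof.
rewrite big_ord_recr addrC; congr (_ + _); apply: eq_bigr => i _.
by congr F; apply: val_inj; apply: esym (lift_max i).
Qed.

Lemma lift_tperm x y : hat (tperm x y) = tperm (lft x) (lft y).
Proof.
apply/permP => z; case: (unliftP ord_max z) => [k|] ->.
  rewrite lift_perm_lift; have [->|ne_x] := eqVneq k x; first by rewrite !tpermL.
  have [->|ne_y] := eqVneq k y; first by rewrite !tpermR.
  by rewrite !tpermD ?(inj_eq lift_inj) // eq_sym.
by rewrite lift_perm_id tpermD // eq_sym neq_lift.
Qed.

Lemma porbit_lift_max s : porbit (hat s) ord_max = [set ord_max].
Proof.
apply/setP => z; rewrite inE; apply/porbitP/eqP => [[i ->]|->].
  elim: i => [|i IHi]; first by rewrite expg0 perm1.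
  by rewrite expgSr permM IHi lift_perm_id.
by exists 0%N; rewrite expg0 perm1.
Qed.

Lemma prod_porbits_lift (R : comNzRingType) (g : nat -> R) s :
  \prod_(C in porbits (hat s) :\ porbit (hat s) ord_max) g #|C| = cycle_weight g s.
Proof.
rewrite -(prod_porbits_intertwine (f := lift ord_max) (s := hat s)) //; first last.
- by move=> x; rewrite lift_perm_lift.
- exact: lift_inj.
apply: eq_bigl => C; rewrite inE andbC; apply: andb_id2l => sC.
rewrite inE eq_sym porbits_eqE //; apply/idP/subsetP => [maxC y yC|C_codom].
  case: (unliftP ord_max y) => [k ->|eq_y]; first exact: codom_f.
  by rewrite -eq_y yC in maxC.
by apply/negP => /C_codom/codomP[k /eqP]; rewrite (negPf (neq_lift _ _)).
Qed.

Lemma cycle_weight_lift (R : comNzRingType) (g : nat -> R) s :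
  cycle_weight g (hat s) = g 1%N * cycle_weight g s.
Proof.
rewrite -prod_porbits_lift /cycle_weight (big_setD1 (porbit (hat s) ord_max)) /=.
  by rewrite porbit_lift_max cards1.
exact: porbit_in_porbits.
Qed.

(** For [i] other than the last point, the transposition inserts the last point into an existing
    cycle and the number of cycles stays the same. *)
Lemma cycle_count_lift (R : comNzRingType) (u : R) s (i : 'I_n.+1) :
  cycle_weight (fun=> u) (hat s * tperm i ord_max)%g
  = (if i == ord_max then u else 1) * cycle_weight (fun=> u) s.
Proof.
case: eqP => [->|/eqP ne_i]; first by rewrite tperm1 mulg1 cycle_weight_lift.
have max_i : ord_max \notin porbit (hat s) i.
  by rewrite porbit_sym porbit_lift_max inE.
rewrite cycle_weight_mulC cycle_weight_join // -prod_porbits_lift mul1r.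
rewrite [RHS](big_setD1 (porbit (hat s) i)) /=.
  by congr (_ * _); apply: eq_bigl => C; rewrite !inE andbCA.
by rewrite !inE porbit_in_porbits andbT eq_porbit_mem porbit_sym.
Qed.

Lemma sum_perm_lift (V : nmodType) (F : 'S_n.+1 -> V) :
  \sum_w F w = \sum_(w : 'S_n) \sum_i F (hat w * tperm i ord_max)%g.
Proof.
pose h (wi : 'S_n * 'I_n.+1) := (hat wi.1 * tperm wi.2 ord_max)%g.
have h_inj : injective h.
  move=> [w i] [w' i'] eq_h; have eq_i : i = i'.
    have := congr1 (fun s : 'S_n.+1 => s ord_max) eq_h.
    by rewrite /h !permM /= !lift_perm_id !tpermR.
  rewrite -eq_i in eq_h *; congr (_, _); apply/permP => x.
  have /(congr1 (fun s : 'S_n.+1 => s (lft x))) := mulIg _ _ _ eq_h.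
  by rewrite /= !lift_perm_lift => /lift_inj.
have h_bij : bijective h.
  by apply: inj_card_bij => //; rewrite card_prod !card_Sn card_ord factS mulnC.
rewrite pair_bigA /= (reindex h); last exact: onW_bij.
by [].
Qed.

End LiftPerm.

Section EvolutionEquation.
Variables (R : comNzRingType) (p : nat -> R) (d : nat -> {additive R -> R}).
Variable bound : R -> nat.
Hypothesis p0 : p 0%N = 0.
Hypothesis dM : forall k f g, d k (f * g) = d k f * g + f * d k g.
Hypothesis dp : forall i j, d i (p j) = i%:R *+ (i == j).
Hypothesis d_comm : forall i j f, d i (d j f) = d j (d i f).
Hypothesis d_bound : forall f k, (bound f <= k)%N -> d k f = 0.

Local Notation K := (cutjoin p d bound).
Local Notation P := ( *%R (p 1%N)).
Local Notation Phi := (cycle_weight p).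

Let KB : {morph K : f g / f - g}. Proof. exact: cutjoinB. Qed.
Let PB : {morph P : f g / f - g}. Proof. by move=> f g; rewrite mulrBr. Qed.
Let KPB : {morph commutator K P : f g / f - g}. Proof. exact: commutatorB. Qed.

Lemma morphB_sum (V : zmodType) (f : V -> V) (I : Type) (r : seq I) (Q : pred I) (F : I -> V) :
  {morph f : x y / x - y} -> f (\sum_(i <- r | Q i) F i) = \sum_(i <- r | Q i) f (F i).
Proof.
move=> fB; have f0 : f 0 = 0 by rewrite -{1}(subrr 0) fB subrr.
exact: (big_morph f (morphB_D fB) f0).
Qed.

Let morphB_Mn (V : zmodType) (f : V -> V) n x : {morph f : x y / x - y} -> f (x *+ n) = f x *+ n.
Proof.
by move=> fB; rewrite -[n in LHS]card_ord -sumr_const morphB_sum // sumr_const card_ord.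
Qed.

Variable n : nat.
Implicit Types (t w b : 'S_n) (s : 'S_n.+1).
Local Notation hat s := (lift_perm ord_max ord_max s).
Local Notation lft i := (lift (@ord_max n) i).

Let KPhi m (s : 'S_m) : K (Phi s) = \sum_x \sum_(y | y != x) Phi (s * tperm x y)%g.
Proof.
rewrite cutjoin_cycle_weight //; apply: eq_bigr => x _; apply: eq_bigr => y _.
exact: cycle_weight_mulC.
Qed.

(* The action of the Jucys-Murphy element of the last point. *)
Definition murphy_sum s : R := \sum_(i < n) Phi (s * tperm (lft i) ord_max)%g.

Lemma murphy_sumE s :
  murphy_sum s *+ 2
  = K (Phi s) - \sum_x \sum_(y | y != x) Phi (s * hat (tperm x y))%g.
Proof.
rewrite KPhi sum_ord_lift big_mkcond sum_ord_lift /= eqxx add0r.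
have -> : \sum_(i < n) (if lft i != ord_max then Phi (s * tperm ord_max (lft i))%g else 0)
    = murphy_sum s.
  by apply: eq_bigr => i _; rewrite eq_sym neq_lift tpermC.
rewrite mulr2n; set X := (X in _ - X).
have -> : \sum_(i < n) \sum_(y | y != lft i) Phi (s * tperm (lft i) y)%g = murphy_sum s + X.
  rewrite -big_split; apply: eq_bigr => i _ /=.
  rewrite big_mkcond sum_ord_lift /= neq_lift; congr (_ + _).
  rewrite [RHS]big_mkcond; apply: eq_bigr => j _ /=.
  by rewrite (inj_eq lift_inj) lift_tperm.
by rewrite addrA addrK.
Qed.

(** The last point is fixed by the lift and contributes a factor [p 1]; the two double sums of
    [murphy_sumE] thereby become K P and P K. *)
Lemma murphy_sum_lift t : murphy_sum (hat t) *+ 2 = commutator K P (Phi t).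
Proof.
rewrite murphy_sumE cycle_weight_lift /commutator; congr (_ - _).
rewrite KPhi mulr_sumr; apply: eq_bigr => x _; rewrite mulr_sumr.
by apply: eq_bigr => y _; rewrite lift_permM cycle_weight_lift.
Qed.

(** [murphy_sumE] is applied to each hat t * t_i. The full sum gives K after the commutator; the
    subtracted one gives the commutator after K, once the transpositions of S_n are moved past the
    t_i. *)
Lemma murphy_sum2_lift t :
  (\sum_(i < n) murphy_sum (hat t * tperm (lft i) ord_max)%g) *+ 4
  = commutator K (commutator K P) (Phi t).
Proof.
rewrite (mulrnA _ 2 2) -sumrMnl; under eq_bigr => i _ do rewrite murphy_sumE.
rewrite sumrB mulrnBl {1}/commutator; congr (_ - _).
  by rewrite -murphy_sum_lift morphB_Mn // morphB_sum.
rewrite KPhi morphB_sum // exchange_big -sumrMnl; apply: eq_bigr => x _ /=.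
rewrite exchange_big morphB_sum // -sumrMnl; apply: eq_bigr => y _ /=.
rewrite -murphy_sum_lift -(lift_permM _ ord_max); congr (_ *+ 2).
(* The Jucys-Murphy element commutes with S_n: conjugation by a transposition of S_n only permutes
   its terms t_i. *)
rewrite /murphy_sum (reindex_inj (@perm_inj _ (tperm x y))) /=.
apply: eq_bigr => i _; congr (Phi _); rewrite -!mulgA; congr (_ * _)%g.
rewrite [LHS]conjgC; congr (_ * _)%g.
by rewrite tpermJ lift_perm_lift lift_perm_id tpermK.
Qed.

Variables u v : R.
Hypotheses (du : forall k, d k u = 0) (dv : forall k, d k v = 0).

Definition hypermap_weight m (w b : 'S_m) : R :=
  cycle_weight (fun=> u) w * cycle_weight (fun=> v) b * Phi (w * b)%g.

Definition hypermap_sum m : R := \sum_(w : 'S_m) \sum_(b : 'S_m) hypermap_weight w b.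

Local Notation evol := (evolution p d bound (u * v *+ 4) ((u + v) *+ 2)).

(** This is the expansion of (u + X)(v + X), where X is the sum of the t_i: the terms with [i] or
    [j] equal to [ord_max] supply u and v. In terms of the doubled operator, X acts as half of
    [K, P] and X^2 as a quarter of [K, [K, P]]. *)
Lemma evolution_Phi t :
  (\sum_i \sum_j (if i == ord_max then u else 1) * (if j == ord_max then v else 1)
     * Phi (hat t * tperm i ord_max * tperm ord_max j)%g) *+ 4 = evol (Phi t).
Proof.
rewrite /evolution -murphy_sum2_lift -murphy_sum_lift.
rewrite sum_ord_lift eqxx sum_ord_lift eqxx tperm1 !mulg1 cycle_weight_lift.
have nmax i : (lft i == ord_max) = false by rewrite eq_sym (negPf (neq_lift _ _)).
have -> : \sum_(j < n) u * (if lft j == ord_max then v else 1)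
    * Phi (hat t * tperm ord_max (lft j))%g = u * murphy_sum (hat t).
  by rewrite mulr_sumr; apply: eq_bigr => j _; rewrite nmax mulr1 tpermC.
have -> : \sum_(i < n) \sum_j (if lft i == ord_max then u else 1)
      * (if j == ord_max then v else 1)
      * Phi (hat t * tperm (lft i) ord_max * tperm ord_max j)%g
    = v * murphy_sum (hat t)
      + \sum_(i < n) murphy_sum (hat t * tperm (lft i) ord_max)%g.
  rewrite mulr_sumr -big_split; apply: eq_bigr => i _ /=.
  rewrite nmax sum_ord_lift eqxx mul1r tperm1 mulg1; congr (_ + _).
  by apply: eq_bigr => j _; rewrite nmax !mul1r [tperm ord_max _]tpermC.
ring.
Qed.

Lemma evolution_scale (a f : R) : (forall k, d k a = 0) -> evol (a * f) = a * evol f.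
Proof.
move=> da; have Ka g : K (a * g) = a * K g.
  have d_ag k : d k (a * g) = a * d k g by rewrite dM da mul0r add0r.
  rewrite (cutjoinE (N := bound g) _ d_comm d_bound); last first.
    by move=> k /d_bound dg; rewrite d_ag dg mulr0.
  rewrite /cutjoin /cutjoin_upto mulr_sumr; apply: eq_bigr => i _.
  rewrite mulr_sumr; apply: eq_bigr => j _.
  by rewrite !d_ag !dM !da; ring.
have Pa g : P (a * g) = a * P g by rewrite mulrCA.
have comm_a (X Y : R -> R) : (forall g, X (a * g) = a * X g) ->
    (forall g, Y (a * g) = a * Y g) ->
    forall g, commutator X Y (a * g) = a * commutator X Y g.
  by move=> Xa Ya g; rewrite /commutator !(Xa, Ya) -mulrBr.
have KPa := comm_a _ _ Ka Pa.
rewrite /evolution KPa (comm_a _ _ Ka KPa).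
by ring.
Qed.

Lemma evolutionB : {morph evol : f g / f - g}.
Proof.
by move=> f g; rewrite /evolution KPB commutatorB // !mulrBr; ring.
Qed.

Lemma der_prod_const (I : finType) (A : {set I}) (a : R) k :
  (forall k, d k a = 0) -> d k (\prod_(i in A) a) = 0.
Proof.
move=> da; rewrite prodr_const; elim: #|A| => [|m IHm]; first exact: (der_natr dM k 1).
by rewrite exprS dM da IHm mul0r mulr0 addr0.
Qed.

Lemma hypermap_sum_evolution : hypermap_sum n.+1 *+ 4 = evol (hypermap_sum n).
Proof.
pose a w b := cycle_weight (fun=> u) w * cycle_weight (fun=> v) b.
have da (w b : 'S_n) k : d k (a w b) = 0.
  by rewrite dM !der_prod_const // mulr0 mul0r addr0.
transitivity (\sum_(w : 'S_n) \sum_(b : 'S_n) evol (a w b * Phi (b * w)%g)).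
  rewrite /hypermap_sum sum_perm_lift -sumrMnl; apply: eq_bigr => w _.
  (* Inversion puts the transposition of the black permutation on the left, so that both
     transpositions meet inside the product; conjugation then brings it to the form hat (b w) t_i
     t_j. *)
  transitivity ((\sum_i \sum_(b : 'S_n) \sum_j
    hypermap_weight (hat w * tperm i ord_max)%g (tperm ord_max j * hat b)%g) *+ 4).
    congr (_ *+ 4); apply: eq_bigr => i _; rewrite (reindex_inj invg_inj) /=.
    rewrite sum_perm_lift (reindex_inj invg_inj) /=; apply: eq_bigr => b _.
    by apply: eq_bigr => j _; rewrite invMg tpermV lift_permV invgK [tperm ord_max _]tpermC.
  rewrite exchange_big -sumrMnl; apply: eq_bigr => b _ /=.
  rewrite evolution_scale // -evolution_Phi mulrnAr; congr (_ *+ 4).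
  rewrite mulr_sumr; apply: eq_bigr => i _; rewrite mulr_sumr; apply: eq_bigr => j _.
  rewrite /hypermap_weight /a cycle_count_lift.
  rewrite [cycle_weight (fun=> v) (_ * _)%g]cycle_weight_mulC [tperm ord_max j]tpermC cycle_count_lift.
  rewrite !mulgA [cycle_weight p _]cycle_weight_mulC !mulgA lift_permM.
  by rewrite mulrACA [X in X * _ = _]mulrC [RHS]mulrA.
rewrite (morphB_sum _ _ _ evolutionB); apply: eq_bigr => w _.
rewrite (morphB_sum _ _ _ evolutionB); apply: eq_bigr => b _.
by rewrite /hypermap_weight -/(a w b) (cycle_weight_mulC p w).
Qed.

End EvolutionEquation.

(** * The exponential formula *)

Section ExtendPerm.
Variables (T' T : finType) (f : T' -> T).
Hypothesis f_inj : injective f.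
Implicit Types s t : {perm T'}.

Definition extend_fun s x := if [pick y | f y == x] is Some y then f (s y) else x.

Lemma extend_funE s y : extend_fun s (f y) = f (s y).
Proof.
rewrite /extend_fun; case: pickP => [z /eqP/f_inj-> //|/(_ y)].
by rewrite eqxx.
Qed.

Lemma extend_fun_out s x : x \notin codom f -> extend_fun s x = x.
Proof.
move=> x_out; rewrite /extend_fun; case: pickP => // y /eqP eq_x.
by rewrite -eq_x codom_f in x_out.
Qed.

Lemma extend_fun_inj s : injective (extend_fun s).
Proof.
move=> x y; case: (boolP (x \in codom f)) => [/codomP[a ->]|x_out];
  case: (boolP (y \in codom f)) => [/codomP[b ->]|y_out].
- by rewrite !extend_funE => /f_inj/perm_inj->.
- by rewrite extend_funE extend_fun_out // => eq_y; rewrite -eq_y codom_f in y_out.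
- by rewrite extend_funE extend_fun_out // => eq_x; rewrite eq_x codom_f in x_out.
by rewrite !extend_fun_out.
Qed.

Definition extend_perm s : {perm T} := perm (@extend_fun_inj s).

Lemma extend_permE s y : extend_perm s (f y) = f (s y).
Proof. by rewrite permE extend_funE. Qed.

Lemma extend_perm_inj : injective extend_perm.
Proof.
move=> s t eq_st; apply/permP => y; apply: f_inj.
by rewrite -!extend_permE eq_st.
Qed.

Lemma sum_Sym_codom (V : nmodType) (F : {perm T} -> V) (S : {set T}) :
  S =i codom f -> \sum_(w in Sym S) F w = \sum_s F (extend_perm s).
Proof.
move=> SE; rewrite -(big_imset _ (in2W extend_perm_inj)) /=; apply: eq_bigl => w.
have -> // : Sym S = [set extend_perm s | s in {perm T'}].
apply/esym/eqP; rewrite eqEcard; apply/andP; split.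
  apply/subsetP => _ /imsetP[s _ ->]; rewrite inE; apply/subsetP => x.
  rewrite inE SE; apply: contraR => x_out; apply/eqP.
  by rewrite /aperm permE extend_fun_out.
rewrite card_imset; last exact: extend_perm_inj.
rewrite card_Sym (eq_card SE) card_codom // -cardsT -(card_Sym [set: T']).
by apply: subset_leq_card; apply/subsetP.
Qed.

End ExtendPerm.

Definition adjacent (T : finType) (w b : {perm T}) : rel T :=
  [rel x y | (y \in porbit w x) || (y \in porbit b x)].

(** Paths may run through all of [T], but they stay in [S] when [S] is stable under both
    permutations. *)
Definition transitive_on (T : finType) (S : {set T}) (w b : {perm T}) : bool :=
  [forall x in S, forall y in S, connect (adjacent w b) x y].

Section Stable.
Variable T : finType.
Implicit Types (w b s t : {perm T}) (S C : {set T}) (x y : T).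

Definition stable S w := [forall x, (w x \in S) == (x \in S)].

Lemma stableP S w : reflect (forall x, (w x \in S) = (x \in S)) (stable S w).
Proof. by apply: (iffP forallP) => h x; apply/eqP/h. Qed.

Lemma stable_norm S w : stable S w = (w \in 'N(S | 'P)%g).
Proof. by apply/stableP/astabsP => h x; apply: h. Qed.

Lemma stableC S w : stable (~: S) w = stable S w.
Proof.
apply/stableP/stableP => h x; last by rewrite !inE h.
by have := h x; rewrite !inE => /negb_inj.
Qed.

Lemma stable_Sym S w : w \in Sym S -> stable S w.
Proof. by rewrite inE => Sw; apply/stableP => x; rewrite perm_closed. Qed.

Lemma stable_porbit S w x : stable S w -> x \in S -> porbit w x \subset S.
Proof.
move=> /stableP wS xS; apply/subsetP => y /porbitP[i ->].
by elim: i => [|i IHi]; rewrite ?expg0 ?perm1 // expgSr permM wS.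
Qed.

Lemma stableM S w b : stable S w -> stable S b -> stable S (w * b)%g.
Proof. by move=> /stableP wS /stableP bS; apply/stableP => x; rewrite permM bS wS. Qed.

Section Weight.
Variables (R : comNzRingType) (g : nat -> R).

Definition weight_on S s : R := \prod_(C in porbits s | C \subset S) g #|C|.

Lemma weight_on_agree S s t :
  stable S s -> {in S, s =1 t} -> weight_on S s = weight_on S t.
Proof.
move=> sS st; have orb x : x \in S -> porbit t x = porbit s x.
  by move=> xS; apply: porbit_agree st _; apply: stable_porbit.
apply: eq_bigl => C; apply/andP/andP => -[/imsetP[x _ ->] CS]; split=> //.
- by rewrite -orb ?porbit_in_porbits // (subsetP CS) ?porbit_id.
- by rewrite orb ?porbit_in_porbits // (subsetP CS) ?porbit_id.
Qed.

Lemma weight_on_split S s : stable S s ->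
  cycle_weight g s = weight_on S s * weight_on (~: S) s.
Proof.
move=> sS; rewrite /cycle_weight (bigID (fun C : {set T} => C \subset S)) /=.
congr (_ * _); apply: eq_bigl => C; apply: andb_id2l => /imsetP[x _ ->].
have [xS|xS] := boolP (x \in S).
  rewrite stable_porbit //; apply/esym/negP => /subsetP/(_ x (porbit_id s x)).
  by rewrite inE xS.
rewrite [RHS]stable_porbit ?stableC ?inE //; apply/negP => /subsetP/(_ x (porbit_id s x)).
by rewrite (negPf xS).
Qed.

End Weight.

(** The factors are recovered by restricting to [S] and to its complement. *)
Lemma sum_stable (V : nmodType) S (F : {perm T} -> V) :
  \sum_(w | stable S w) F w = \sum_(w in Sym S) \sum_(b in Sym (~: S)) F (w * b)%g.
Proof.
have mulE w b x : w \in Sym S -> b \in Sym (~: S) ->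
    (w * b)%g x = if x \in S then w x else b x.
  rewrite !inE => wS bS; rewrite permM; case: ifP => xS.
    by rewrite (out_perm bS) // inE negbK perm_closed.
  by rewrite (out_perm wS) ?xS.
rewrite pair_big_dep /=.
rewrite (reindex_onto (fun wb : {perm T} * {perm T} => (wb.1 * wb.2)%g)
  (fun w => (restr_perm S w, restr_perm (~: S) w))) /= => [|w wS]; last first.
  have wS' : stable (~: S) w by rewrite stableC.
  have := wS; rewrite stable_norm => wN; have := wS'; rewrite stable_norm => wN'.
  apply/permP => x; rewrite mulE ?inE ?restr_perm_on //.
  by case: ifPn => xS; rewrite restr_permE // inE.
apply: eq_bigl => -[w b] /=; apply/andP/andP => [[st /eqP[<- <-]]|[wS bS]].
  by rewrite !inE !restr_perm_on.
have st : stable S (w * b)%g.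
  apply/stableP => x; rewrite mulE //; case: ifPn => xS.
    by rewrite (stableP S w (stable_Sym wS)) xS.
  have := stable_Sym bS; rewrite stableC => /stableP->.
  exact: negPf.
split=> //; have := st; rewrite stable_norm => stN.
have := st; rewrite -stableC stable_norm => stN'.
move: (wS) (bS); rewrite !inE => wS' bS'.
apply/eqP; congr (_, _); apply/permP => x.
  have [xS|xS] := boolP (x \in S); first by rewrite restr_permE // mulE // xS.
  by rewrite (out_perm (restr_perm_on _ _)) // (out_perm wS').
have [xS|xS] := boolP (x \in ~: S).
  by rewrite restr_permE // mulE // ifN // -in_setC.
by rewrite (out_perm (restr_perm_on _ _)) // (out_perm bS').
Qed.

End Stable.

Lemma connect_map (T' T : finType) (f : T' -> T) (e' : rel T') (e : rel T) x y :
  (forall a b, e' a b -> e (f a) (f b)) -> connect e' x y -> connect e (f x) (f y).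
Proof.
move=> fe /connectP[q]; elim: q x => [|z q IHq] x /=; first by move=> _ ->.
by case/andP=> /fe/connect1 xz /IHq{}IHq /IHq; apply: connect_trans.
Qed.

Lemma connect_preim (T' T : finType) (f : T' -> T) (e' : rel T') (e : rel T) x y :
    (forall a z, e (f a) z -> exists2 b, z = f b & e' a b) ->
  connect e (f x) y -> exists2 b, y = f b & connect e' x b.
Proof.
move=> fe /connectP[q]; elim: q x => [|z q IHq] x /=; first by move=> _ ->; exists x.
case/andP=> /fe[a -> xa] /IHq{}IHq /IHq[b -> ab]; exists b => //.
exact: connect_trans (connect1 xa) ab.
Qed.

Section Components.
Variable T : finType.
Implicit Types (w b : {perm T}) (S : {set T}) (x y : T).

Lemma connect_adjacent_sym w b : connect_sym (adjacent w b).
Proof.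
apply: sym_connect_sym => x y.
by rewrite /adjacent /= porbit_sym [y \in porbit b _]porbit_sym.
Qed.

Definition component w b x := [set y | connect (adjacent w b) x y].

Lemma stable_component w b x : stable (component w b x) w && stable (component w b x) b.
Proof.
have adj s y : s = w \/ s = b ->
    connect (adjacent w b) x (s y) = connect (adjacent w b) x y.
  move=> s_wb; apply: (same_connect_r (connect_adjacent_sym w b)).
  rewrite connect_adjacent_sym; apply: connect1 => /=.
  have sy : s y \in porbit s y by rewrite porbit_sym porbit_app porbit_id.
  by apply/orP; case: s_wb sy => -> sy; [left | right].
by apply/andP; split; apply/stableP => y; rewrite !inE adj; auto.
Qed.

Lemma connect_stable S w b x y : stable S w -> stable S b -> x \in S ->
  connect (adjacent w b) x y -> y \in S.
Proof.
move=> wS bS xS /connectP[q]; elim: q x xS => [|z q IHq] x xS /=; first by move=> _ ->.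
case/andP=> xz qz; apply: IHq qz.
by case/orP: xz => [/(subsetP (stable_porbit wS xS))|/(subsetP (stable_porbit bS xS))].
Qed.

Lemma component_eq S w b x : stable S w -> stable S b -> x \in S ->
  (component w b x == S) = transitive_on S w b.
Proof.
move=> wS bS xS; apply/eqP/forall_inP => [eq_S y|tr_S].
  rewrite -eq_S inE connect_adjacent_sym => yx; apply/forall_inP => z.
  by rewrite inE; apply: connect_trans yx.
apply/setP => y; rewrite inE; apply/idP/idP; first exact: connect_stable.
by move/forall_inP: (tr_S x xS) => tr_x; apply: tr_x.
Qed.

Lemma transitive_on_agree S w b w' b' :
    stable S w -> stable S b -> {in S, w =1 w'} -> {in S, b =1 b'} ->
  transitive_on S w b -> transitive_on S w' b'.
Proof.
move=> wS bS ww' bb' tr_S; apply/forall_inP => x xS; apply/forall_inP => y yS.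
have /connectP[q] := forall_inP (forall_inP tr_S x xS) y yS.
elim: q x xS => [|z q IHq] x xS /=; first by move=> _ ->.
case/andP=> xz qz eq_y; apply: (connect_trans (y := z)).
  apply: connect1; move: xz; rewrite /adjacent /=.
  rewrite (porbit_agree ww' (stable_porbit wS xS)).
  by rewrite (porbit_agree bb' (stable_porbit bS xS)).
apply: IHq qz eq_y.
by case/orP: xz => [/(subsetP (stable_porbit wS xS))|/(subsetP (stable_porbit bS xS))].
Qed.

End Components.

Section Exponential.
Variables (R : comNzRingType) (p : nat -> R) (u v : R).

Local Notation hw := (hypermap_weight p u v).

Definition connected_sum m : R :=
  \sum_(w : 'S_m) \sum_(b : 'S_m | transitive_on setT w b) hw w b.

Definition pair_on (T : finType) (S : {set T}) (w b : {perm T}) : R :=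
  weight_on (fun=> u) S w * weight_on (fun=> v) S b * weight_on p S (w * b)%g.

Section Transport.
Variables (T : finType) (S : {set T}).

Let f (i : 'I_#|S|) : T := enum_val i.
Let f_inj : injective f. Proof. exact: enum_val_inj. Qed.
Let fS : S =i codom f.
Proof.
move=> x; apply/idP/codomP => [xS|[i ->]]; last exact: enum_valP.
by exists (enum_rank_in xS x); rewrite /f enum_rankK_in.
Qed.
Let ext := extend_perm f_inj.

Let weight_ext (g : nat -> R) (s : {perm T}) (s' : 'S_#|S|) :
  (forall i, s (f i) = f (s' i)) -> weight_on g S s = cycle_weight g s'.
Proof.
move=> fs; rewrite -(prod_porbits_intertwine f_inj fs).
by apply: eq_bigl => C; rewrite (eq_subset_r fS).
Qed.

Let pair_ext w b : pair_on S (ext w) (ext b) = hw w b.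
Proof.
rewrite /pair_on /hypermap_weight (weight_ext _ (s' := w)); last exact: extend_permE.
rewrite (weight_ext _ (s' := b)); last exact: extend_permE.
by rewrite (weight_ext _ (s' := (w * b)%g)) // => i; rewrite !permM !extend_permE.
Qed.

Let transitive_ext w b : transitive_on S (ext w) (ext b) = transitive_on setT w b.
Proof.
have adj i j : adjacent w b i j -> adjacent (ext w) (ext b) (f i) (f j).
  rewrite /adjacent /= (porbit_intertwine (extend_permE f_inj w)).
  rewrite (porbit_intertwine (extend_permE f_inj b)).
  by case/orP => ij; rewrite (imset_f f ij) ?orbT.
have adj' i z : adjacent (ext w) (ext b) (f i) z -> exists2 j, z = f j & adjacent w b i j.
  rewrite /adjacent /= (porbit_intertwine (extend_permE f_inj w)).
  rewrite (porbit_intertwine (extend_permE f_inj b)).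
  by case/orP => /imsetP[j ij ->]; exists j; rewrite //= ij ?orbT.
apply/forall_inP/forall_inP => [tr i _|tr x].
  apply/forall_inP => j _; have /forall_inP/(_ (f j)) := tr (f i) (enum_valP i).
  by move=> /(_ (enum_valP j))/(connect_preim adj')[k /f_inj->].
rewrite fS => /codomP[i ->]; apply/forall_inP => y; rewrite fS => /codomP[j ->].
by apply: connect_map adj _; have /forall_inP := tr i (in_setT i); apply; rewrite inE.
Qed.

Lemma sum_pair_on :
  \sum_(w in Sym S) \sum_(b in Sym S) pair_on S w b = hypermap_sum p u v #|S|.
Proof.
rewrite (sum_Sym_codom f_inj _ fS); apply: eq_bigr => w _.
rewrite (sum_Sym_codom f_inj _ fS); apply: eq_bigr => b _; exact: pair_ext.
Qed.

Lemma sum_pair_on_connected :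
  \sum_(w in Sym S) \sum_(b in Sym S | transitive_on S w b) pair_on S w b
  = connected_sum #|S|.
Proof.
rewrite (sum_Sym_codom f_inj _ fS); apply: eq_bigr => w _.
rewrite big_mkcondr (sum_Sym_codom f_inj _ fS) [RHS]big_mkcond.
by apply: eq_bigr => b _; rewrite /= pair_ext transitive_ext.
Qed.

End Transport.

Variable d : nat.
Implicit Types (S : {set 'I_d}) (w b : 'S_d).

(** Such a pair stabilises [S], hence splits into a transitive pair on [S] and an arbitrary pair on
    the complement; all weights are multiplicative for this splitting. *)
Lemma sum_component S x : x \in S ->
  \sum_w \sum_(b | component w b x == S) hw w b
  = connected_sum #|S| * hypermap_sum p u v #|~: S|.
Proof.
move=> xS.
have agree w1 w2 : w1 \in Sym S -> w2 \in Sym (~: S) ->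
    {in S, w1 =1 (w1 * w2)%g} /\ {in ~: S, w2 =1 (w1 * w2)%g}.
  rewrite !inE => w1S w2S; split=> y; rewrite ?inE => yS; rewrite permM.
    by rewrite (out_perm w2S) // inE negbK perm_closed.
  by rewrite (out_perm w1S).
pose t w b := if transitive_on S w b then hw w b else 0.
transitivity (\sum_(w | stable S w) \sum_(b | stable S b) t w b).
  rewrite [RHS]big_mkcond; apply: eq_bigr => w _; case: ifPn => [wS|wNS].
    rewrite [LHS]big_mkcond [RHS]big_mkcond; apply: eq_bigr => b _.
    case: (boolP (stable S b)) => [bS|bNS]; first by rewrite component_eq.
    by case: eqP => // eqS; have := stable_component w b x; rewrite eqS (negPf bNS) andbF.
  apply: big1 => b /eqP eqS; have := stable_component w b x.
  by rewrite eqS (negPf wNS).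
rewrite sum_stable -sum_pair_on_connected -sum_pair_on mulr_suml.
apply: eq_bigr => w1 w1S.
under eq_bigr => w2 _ do rewrite sum_stable.
rewrite exchange_big /= big_mkcondr mulr_suml; apply: eq_bigr => b1 b1S.
rewrite mulr_sumr; apply: eq_bigr => w2 w2S.
rewrite mulr_sumr; apply: eq_bigr => b2 b2S.
have [w_in w_out] := agree _ _ w1S w2S; have [b_in b_out] := agree _ _ b1S b2S.
have [w1_st b1_st] := (stable_Sym w1S, stable_Sym b1S).
have [w2_st b2_st] := (stable_Sym w2S, stable_Sym b2S).
have w_st : stable S (w1 * w2)%g by rewrite stableM // -stableC.
have b_st : stable S (b1 * b2)%g by rewrite stableM // -stableC.
have -> : transitive_on S w1 b1 = transitive_on S (w1 * w2)%g (b1 * b2)%g.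
  apply/idP/idP; apply: transitive_on_agree => //.
    by move=> y yS; rewrite -w_in.
  by move=> y yS; rewrite -b_in.
rewrite /t; case: ifP => _; last by rewrite mul0r.
rewrite /hypermap_weight !(weight_on_split _ w_st) !(weight_on_split _ b_st).
rewrite (weight_on_split _ (stableM w_st b_st)) /pair_on.
rewrite !(weight_on_agree _ w1_st w_in) !(weight_on_agree _ b1_st b_in).
rewrite !(weight_on_agree _ w2_st w_out) !(weight_on_agree _ b2_st b_out).
have wb_in : {in S, (w1 * b1)%g =1 (w1 * w2 * (b1 * b2))%g}.
  move=> y yS; rewrite permM [RHS]permM -w_in // b_in //.
  by rewrite (stableP S w1 w1_st).
have wb_out : {in ~: S, (w2 * b2)%g =1 (w1 * w2 * (b1 * b2))%g}.
  move=> y yS; rewrite permM [RHS]permM -w_out // b_out //.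
  by rewrite (stableP _ w2 w2_st).
rewrite (weight_on_agree _ (stableM w1_st b1_st) wb_in).
rewrite (weight_on_agree _ (stableM w2_st b2_st) wb_out).
ring.
Qed.

(** Pairs with a marked point are sorted by the component [S] of that point. A set of [j] points
    occurs for [j] marked points, and there are 'C(d, j) such sets. *)
Lemma hypermap_sum_exp :
  hypermap_sum p u v d *+ d
  = \sum_(j < d.+1) (connected_sum j * hypermap_sum p u v (d - j)) *+ (j * 'C(d, j)).
Proof.
pose G j := (connected_sum j * hypermap_sum p u v (d - j)) *+ j.
transitivity (\sum_(x : 'I_d) \sum_(S : {set 'I_d} | x \in S)
    connected_sum #|S| * hypermap_sum p u v #|~: S|).
  rewrite -[d in _ *+ d]card_ord -sumr_const; apply: eq_bigr => x _.
  transitivity (\sum_(S : {set 'I_d} | x \in S) \sum_w \sum_(b | component w b x == S) hw w b).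
    rewrite exchange_big; apply: eq_bigr => w _ /=.
    rewrite [LHS](partition_big (fun b => component w b x) (fun S => x \in S)) //=.
    by move=> b _; rewrite inE.
  by apply: eq_bigr => S xS; rewrite sum_component.
rewrite (exchange_big_dep xpredT) //=.
transitivity (\sum_(S : {set 'I_d}) G #|S|).
  apply: eq_bigr => S _; rewrite sumr_const /G.
  by have -> : #|~: S| = (d - #|S|)%N by rewrite cardsCs setCK card_ord.
rewrite (partition_big (fun S : {set 'I_d} => inord #|S| : 'I_d.+1) xpredT) //=.
apply: eq_bigr => j _; have lejd : (j <= d)%N by rewrite -ltnS.
rewrite (eq_bigr (fun=> G j)) => [|S /eqP <-]; last first.
  by rewrite inordK // ltnS -[d in (_ <= d)%N]card_ord max_card.
rewrite sumr_const mulrnA; congr (_ *+ _).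
rewrite -[d in 'C(d, _)]card_ord -card_draws; apply: eq_card => S.
rewrite !inE; apply/eqP/eqP => [<-|->]; last by rewrite inord_val.
by rewrite /= inordK // ltnS -[d in (_ <= d)%N]card_ord max_card.
Qed.

End Exponential.

(** * Counting dessins *)

Section Labels.
Variables (d m : nat) (s : 'S_d).

(** Labellings that amount to a bijection from the cycles of [s] to the labels. The lengths [mu] are
    left out, being determined by the labelling. *)
Definition cycle_labels : {set {ffun 'I_d -> 'I_m}} :=
  [set lab : {ffun 'I_d -> 'I_m} | [forall e, forall e', (lab e == lab e') == (e' \in porbit s e)]
    && [forall i, (0 < #|[set e | lab e == i]|)%N]].

Lemma cycle_labelsP (lab : {ffun 'I_d -> 'I_m}) :
  reflect ((forall e e', (lab e == lab e') = (e' \in porbit s e))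
           /\ forall i, exists e, lab e = i)
          (lab \in cycle_labels).
Proof.
rewrite inE; apply: (iffP andP) => [[/forallP lab_s /forallP lab_i]|[lab_s lab_i]].
  split=> [e e'|i]; first by move/forallP: (lab_s e) => /(_ e')/eqP.
  by have /card_gt0P[e] := lab_i i; rewrite inE => /eqP; exists e.
split; first by apply/forallP => e; apply/forallP => e'; rewrite lab_s.
by apply/forallP => i; apply/card_gt0P; have [e <-] := lab_i i; exists e; rewrite inE.
Qed.

Lemma prod_cycle_labels (R : comNzRingType) (g : nat -> R) lab :
  lab \in cycle_labels -> \prod_i g #|[set e | lab e == i]| = cycle_weight g s.
Proof.
case/cycle_labelsP=> lab_s lab_i.
have fiberE e : [set e' | lab e' == lab e] = porbit s e.
  by apply/setP => e'; rewrite inE eq_sym lab_s.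
have fiber_inj : injective (fun i => [set e | lab e == i]).
  move=> i j eq_ij; have [e le] := lab_i i.
  by have := in_set (fun e => lab e == j) e; rewrite -eq_ij inE le eqxx => /esym/eqP.
have -> : cycle_weight g s
    = \prod_(C in [set [set e | lab e == i] | i in 'I_m]) g #|C|.
  apply: eq_bigl => C; apply/imsetP/imsetP => -[x _ ->].
    by exists (lab x); rewrite ?fiberE.
  by have [e <-] := lab_i x; exists e; rewrite ?fiberE.
by rewrite big_imset //= => i j _ _; apply: fiber_inj.
Qed.

(** A labelling factors through the numbering [q] of the cycles. The remaining map is injective by
    the first condition and onto by the second, so there are [m]! of them when the numbers agree. *)
Lemma card_cycle_labels :
  #|cycle_labels| = if m == #|porbits s| then m`! else 0%N.
Proof.
pose c := #|porbits s|.
pose q e : 'I_c := enum_rank_in (porbit_in_porbits s e) (porbit s e).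
have qE e : enum_val (q e) = porbit s e by rewrite enum_rankK_in ?porbit_in_porbits.
have q_eq e e' : (q e == q e') = (e' \in porbit s e).
  by rewrite -(inj_eq enum_val_inj) !qE eq_porbit_mem porbit_sym.
have q_surj i : exists e, q e == i.
  have /imsetP[e _ eq_i] := enum_valP i; exists e.
  by rewrite -(inj_eq enum_val_inj) qE eq_i.
pose comp (h : {ffun 'I_c -> 'I_m}) : {ffun 'I_d -> 'I_m} := [ffun e => h (q e)].
have comp_inj : injective comp.
  move=> h h' /ffunP eq_h; apply/ffunP => i; have [e /eqP <-] := q_surj i.
  by have := eq_h e; rewrite !ffunE.
have compP h : (comp h \in cycle_labels) = injectiveb h && (m == c).
  apply/cycle_labelsP/andP => [[h_s h_i]|[/injectiveP h_inj /eqP m_c]].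
    have h_inj : injective h.
      move=> i j; have [e /eqP <-] := q_surj i; have [e' /eqP <-] := q_surj j.
      move=> eq_h; apply/eqP; rewrite q_eq -h_s !ffunE eq_h //.
    split; first exact/injectiveP.
    have cardE : #|codom h| = #|'I_m|.
      apply: eq_card => i; rewrite inE; have [e <-] := h_i i.
      by rewrite ffunE codom_f.
    by move: cardE; rewrite card_codom // !card_ord => ->.
  split=> [e e'|i]; first by rewrite !ffunE (inj_eq h_inj) q_eq.
  have le_card : (#|'I_m| <= #|'I_c|)%N by rewrite !card_ord m_c.
  have /codomP[j ->] := inj_card_onto h_inj le_card i.
  by have [e /eqP <-] := q_surj j; exists e; rewrite ffunE.
have -> : cycle_labels = [set comp h | h in [set h : {ffun 'I_c -> 'I_m} | injectiveb h && (m == c)]].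
  apply/setP => lab; apply/idP/imsetP => [lab_valid|[h]]; last by rewrite inE -compP => ? ->.
  have [lab_s lab_i] := cycle_labelsP _ lab_valid.
  pose h := [ffun i => lab (xchoose (q_surj i))].
  have labE : lab = comp h.
    apply/ffunP => e; rewrite !ffunE; apply/eqP; rewrite lab_s -q_eq eq_sym.
    exact: xchooseP (q_surj (q e)).
  by exists h => //; rewrite inE -compP -labE.
rewrite card_imset //; case: eqP => [m_c|_]; last first.
  by apply: eq_card0 => h; rewrite !inE andbF.
have -> : #|[set h : {ffun 'I_c -> 'I_m} | injectiveb h && true]|
    = #|[set h : {ffun 'I_c -> 'I_m} | injectiveb h]|.
  by apply: eq_card => h; rewrite !inE andbT.
by rewrite card_inj_ffuns !card_ord m_c ffactnn.
Qed.

End Labels.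

Section IsomorphismClasses.
Variables d m : nat.
Implicit Types G H : ribbon d m.

Lemma relabel1 G : relabel 1%g G = G.
Proof.
case: G => w b lab; rewrite /relabel /= !conjg1; congr Ribbon.
by apply/ffunP => e; rewrite ffunE invg1 perm1.
Qed.

Lemma relabelM G (g h : 'S_d) : relabel (g * h)%g G = relabel h (relabel g G).
Proof.
rewrite /relabel /= !conjgM; congr Ribbon.
by apply/ffunP => e; rewrite !ffunE invMg permM.
Qed.

Let relabel_act := TotalAction (to := fun G g => relabel g G) relabel1 relabelM.

Lemma card_isomorphism_class G :
  (#|[set H | isomorphic G H]| * #|Aut_b G|)%N = d`!.
Proof.
rewrite -card_Sn -cardsT -(card_orbit_stab relabel_act [set: 'S_d] G).
congr (_ * _)%N; apply: eq_card => x.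
  rewrite inE; apply/existsP/orbitP => [[g /eqP <-]|[g _ <-]]; by exists g.
by rewrite setTI; apply/idP/astab1P; rewrite inE => /eqP.
Qed.

(** By orbit counting 1 / #|Aut_b G| is the size of the class of [G] divided by d!, and the classes
    partition [D]. *)
Lemma sum_isomorphism_classes (D : {set ribbon d m}) :
    (forall G H, isomorphic G H -> (G \in D) = (H \in D)) ->
  \sum_(G in transversal (equivalence_partition (@isomorphic d m) D) D)
    (#|Aut_b G|%:R)^-1 = (#|D|%:R / d`!%:R :> rat).
Proof.
move=> D_iso; set P := equivalence_partition _ _; set X := transversal P D.
have eq_iso : {in D & &, equivalence_rel (@isomorphic d m)}.
  by move=> G H K _ _ _; apply: isomorphic_equivalence.
have partP : partition P D := equivalence_partitionP eq_iso.
have trX : is_transversal X P D := transversalP partP.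
clearbody X; rewrite (card_partition partP) -(pblock_transversal trX).
rewrite big_imset /=; last first.
  by move=> G H XG XH; apply: (pblock_inj trX).
rewrite natr_sum mulr_suml; apply: eq_bigr => G XG.
have DG : G \in D := subsetP (transversal_sub trX) G XG.
have -> : pblock P G = [set H | isomorphic G H].
  apply/setP => H; rewrite inE.
  have [DH|DH] := boolP (H \in D); first by rewrite pblock_equivalence_partition.
  rewrite (_ : isomorphic G H = false); last by apply: contraNF DH => /D_iso <-.
  have [/eqP coverP _ _] := and3P partP.
  apply: contraNF DH => GH; rewrite -coverP; apply/bigcupP.
  by exists (pblock P G); rewrite // pblock_mem // coverP.
rewrite -(card_isomorphism_class G) natrM invfM mulrA divff ?mul1r //.
rewrite pnatr_eq0 -lt0n; apply/card_gt0P; exists G.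
by rewrite inE; have [] := isomorphic_equivalence G G G.
Qed.

End IsomorphismClasses.

Section Dessins.
Variables (d m : nat).
Implicit Types (G H : ribbon d m) (g : 'S_d).

(** The conditions of [dessins], with a number of edges [d] that is not tied to [mu], so that all
    [mu] of the same total share one type. *)
Definition ribbons_of (k l : nat) (mu : 'I_m -> nat) : {set ribbon d m} :=
  [set G | [&& connected G, #|porbits (white G)| == k,
               #|porbits (black G)| == l & labeled_by mu G]].

Let conjE (s g : 'S_d) e : (s ^ g)%g (g e) = g (s e).
Proof. by rewrite permJ. Qed.

Lemma card_porbits_conj (s g : 'S_d) : #|porbits (s ^ g)%g| = #|porbits s|.
Proof.
have -> : porbits (s ^ g)%g = [set g @: C | C : {set 'I_d} in porbits s].
  rewrite -(porbits_intertwine (f := g) (s := (s ^ g)%g)); last exact: conjE.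
  apply/setP => C; rewrite inE andb_idr // => _; apply/subsetP => e _.
  by apply/codomP; exists ((g^-1)%g e); rewrite permKV.
by rewrite card_imset //; apply: imset_inj; apply: perm_inj.
Qed.

Lemma relabel_ribbons_of k l mu g G : G \in ribbons_of k l mu ->
  relabel g G \in ribbons_of k l mu.
Proof.
rewrite !inE /= !card_porbits_conj => /and4P[conn -> -> /andP[/forallP lab_s /forallP lab_i]] /=.
have onto_g (Q : 'I_d -> Prop) : (forall e, Q (g e)) -> forall e, Q e.
  by move=> Qg e; rewrite -(permKV g e).
have labE e : label (relabel g G) (g e) = label G e by rewrite ffunE permK.
have porbE (s : 'S_d) e e' : (g e' \in porbit (s ^ g)%g (g e)) = (e' \in porbit s e).
  by rewrite (porbit_intertwine (s' := s)) ?mem_imset //; apply: perm_inj.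
rewrite /labeled_by; apply/and3P; split.
- apply/forallP; apply: (onto_g) => e; apply/forallP; apply: (onto_g) => e'.
  apply: (connect_map (e' := adjacent_edges G)) => [x y|].
    by rewrite /adjacent_edges /= !porbE.
  by have /forallP := (forallP conn) e; apply.
- apply/forallP; apply: (onto_g) => e; apply/forallP; apply: (onto_g) => e'.
  rewrite !labE /= -conjMg porbE; by move/forallP: (lab_s e); apply.
apply/forallP => i; rewrite -(eqP (lab_i i)); apply/eqP.
rewrite -[RHS](card_imset _ (@perm_inj _ g)); apply: eq_card => e.
move: e; apply: (onto_g) => e; rewrite inE ffunE permK mem_imset ?inE //.
exact: perm_inj.
Qed.

Lemma isomorphic_ribbons_of k l mu G H : isomorphic G H ->
  (G \in ribbons_of k l mu) = (H \in ribbons_of k l mu).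
Proof.
move=> GH; have HG : isomorphic H G.
  have [GG GGH] := isomorphic_equivalence G H G.
  by rewrite -(GGH GH).
move: GH HG => /existsP[g /eqP gG] /existsP[h /eqP hH].
by apply/idP/idP => [/(relabel_ribbons_of g)|/(relabel_ribbons_of h)]; rewrite ?gG ?hH.
Qed.

End Dessins.

Lemma dessin_countE m k l (mu : 'I_m -> nat) d : (\sum_i mu i)%N = d ->
  dessin_count k l mu = #|ribbons_of d k l mu|%:R / d`!%:R.
Proof.
move=> <-; rewrite /dessin_count /dessin_classes sum_isomorphism_classes //.
exact: isomorphic_ribbons_of.
Qed.

Lemma connectedE d m (G : ribbon d m) :
  connected G = transitive_on setT (white G) (black G).
Proof.
apply/forallP/forall_inP => [conn e _|conn e].
  by apply/forall_inP => e' _; have /forallP := conn e; apply.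
by apply/forallP => e'; have /forall_inP := conn e (in_setT e); apply; rewrite inE.
Qed.

Lemma sum_fiber (I J : finType) (f : I -> J) : (\sum_j #|[set i | f i == j]| = #|I|)%N.
Proof.
rewrite -sum1_card (partition_big f xpredT) //=; apply: eq_bigr => j _.
by rewrite -sum1_card; apply: eq_bigl => i; rewrite inE.
Qed.

(** At most one [mu] fits a given ribbon graph, namely the sizes [mu0] of the fibres of its
    labelling. *)
Lemma sum_labeled_by (R : comNzRingType) (p : nat -> R) d m (G : ribbon d m) :
  \sum_(mu : {ffun 'I_m -> 'I_d.+1} |
      [forall i, (0 < mu i)%N] && (\sum_i mu i == d)%N)
    (if labeled_by (fun i => mu i : nat) G then \prod_i p (mu i) else 0)
  = if label G \in cycle_labels m (white G * black G)%g
    then cycle_weight p (white G * black G)%g else 0.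
Proof.
set s := (white G * black G)%g; rewrite -big_mkcondr.
have lt_fiber i : (#|[set e | label G e == i]| < d.+1)%N.
  by rewrite ltnS -[d in (_ <= d)%N]card_ord max_card.
pose mu0 : {ffun 'I_m -> 'I_d.+1} := [ffun i => Ordinal (lt_fiber i)].
case: ifPn => [lab_valid|lab_invalid].
  rewrite (big_pred1 mu0) => [|mu /=].
    rewrite -(prod_cycle_labels p lab_valid); apply: eq_bigr => i _.
    by rewrite ffunE.
  have := lab_valid; rewrite inE => /andP[lab_s lab_i].
  rewrite /labeled_by -/s lab_s /=; apply/andP/eqP => [[_ /forallP mu_i]|->].
    by apply/ffunP => i; apply: val_inj; rewrite ffunE /= (eqP (mu_i i)).
  split; last by apply/forallP => i; rewrite ffunE.
  apply/andP; split; first by apply/forallP => i; rewrite ffunE (forallP lab_i).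
  apply/eqP; rewrite -[RHS]card_ord -(sum_fiber (label G)).
  by apply: eq_bigr => i _; rewrite ffunE.
rewrite big1 // => mu /andP[/andP[/forallP mu_gt0 _] /andP[lab_s /forallP mu_i]].
case/negP: lab_invalid; rewrite inE lab_s; apply/forallP => i.
by rewrite (eqP (mu_i i)).
Qed.

Lemma sum_nat_pred1 (V : nmodType) (F : nat -> V) a n c : (a <= c < n)%N ->
  \sum_(a <= k < n) (if c == k then F k else 0) = F c.
Proof.
move=> c_range; rewrite (bigD1_seq c) ?mem_index_iota ?iota_uniq //= eqxx.
by rewrite big1 ?addr0 // => k /negPf ne_kc; rewrite eq_sym ne_kc.
Qed.

Lemma card_porbits_range n (s : 'S_n) : (0 < n)%N -> (0 < #|porbits s| < n.+1)%N.
Proof.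
case: n s => // n s _; apply/andP; split.
  by apply/card_gt0P; exists (porbit s ord0); apply: porbit_in_porbits.
by rewrite ltnS (leq_trans (leq_imset_card _ _)) ?card_ord.
Qed.

Lemma sum_ribbon (V : nmodType) d m (F : ribbon d m -> V) :
  \sum_G F G = \sum_w \sum_b \sum_lab F (Ribbon w b lab).
Proof.
rewrite pair_bigA pair_bigA /=.
rewrite (reindex (@prod_ribbon d m)) /=; first by apply: eq_bigr => -[[w b] lab].
exists (@ribbon_prod d m) => [[[w b] lab]|G] _ //; exact: ribbon_prodK.
Qed.

Section GeneratingFunction.
Variables (R : comAlgType rat) (p : nat -> R) (u v : R).

Definition connected_gf (d : nat) : R :=
  \sum_(1 <= k < d.+1) \sum_(1 <= l < d.+1) \sum_(1 <= m < d.+1)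
    (m`!%:R^-1 : rat) *:
    \sum_(mu : {ffun 'I_m -> 'I_d.+1} |
           [forall i, (0 < mu i)%N] && (\sum_i mu i == d)%N)
      dessin_count k l (fun i => mu i : nat) *:
        (u ^+ k * v ^+ l * \prod_i p (mu i)).

(** Classes weighted by automorphisms become labelled structures divided by d!. For given [w] and
    [b] only one triple k, l, m contributes, and its [m]! labellings cancel the factor 1/m!.
    Positivity of [d] puts the cycle counts in the ranges starting at 1. *)
Lemma connected_gfE d : (0 < d)%N ->
  connected_gf d = (d`!%:R^-1 : rat) *: connected_sum p u v d.
Proof.
move=> d0.
pose X k l w b := u ^+ k * v ^+ l * cycle_weight p (w * b : 'S_d)%g.
have inner k l m :
    \sum_(mu : {ffun 'I_m -> 'I_d.+1} | [forall i, (0 < mu i)%N] && (\sum_i mu i == d)%N)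
      dessin_count k l (fun i => mu i : nat) *: (u ^+ k * v ^+ l * \prod_i p (mu i))
    = (d`!%:R^-1 : rat) *: \sum_(w : 'S_d) \sum_(b : 'S_d | transitive_on setT w b)
        (if #|porbits w| == k then if #|porbits b| == l then
         X k l w b *+ #|cycle_labels m (w * b)%g| else 0 else 0).
  transitivity ((d`!%:R^-1 : rat) *: \sum_(G : ribbon d m)
      (if [&& connected G, #|porbits (white G)| == k & #|porbits (black G)| == l] then
         u ^+ k * v ^+ l * (if label G \in cycle_labels m (white G * black G)%g
         then cycle_weight p (white G * black G)%g else 0) else 0)).
    under [X in _ = _ *: X]eq_bigr => G _ do rewrite -sum_labeled_by.
    rewrite scaler_sumr.
    transitivity (\sum_(mu : {ffun 'I_m -> 'I_d.+1} |
        [forall i, (0 < mu i)%N] && (\sum_i mu i == d)%N) \sum_(G : ribbon d m)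
        (d`!%:R^-1 : rat) *: (if [&& connected G, #|porbits (white G)| == k & #|porbits (black G)| == l]
          then u ^+ k * v ^+ l * (if labeled_by (fun i => mu i : nat) G
             then \prod_i p (mu i) else 0) else 0)).
      apply: eq_bigr => mu /andP[_ /eqP mu_d]; rewrite (dessin_countE _ _ mu_d).
      rewrite mulrC -scalerA -scaler_sumr; congr (_ *: _).
      rewrite scaler_nat -sumr_const big_mkcond; apply: eq_bigr => G _.
      rewrite inE; case: (connected G) => //=.
      case: (_ == k) => //=; case: (_ == l) => //=.
      by case: ifP => // _; rewrite mulr0.
    rewrite exchange_big; apply: eq_bigr => G _ /=; rewrite -scaler_sumr; congr (_ *: _).
    by case: ifP => _; [rewrite mulr_sumr | rewrite big1].
  congr (_ *: _); rewrite sum_ribbon; apply: eq_bigr => w _.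
  rewrite [RHS]big_mkcond; apply: eq_bigr => b _ /=.
  under eq_bigr => lab _ do rewrite connectedE /=.
  case: (transitive_on _ _ _) => /=; last by rewrite big1.
  case: (_ == k) => /=; last by rewrite big1.
  case: (_ == l) => /=; last by rewrite big1.
  rewrite -sumr_const [RHS]big_mkcond; apply: eq_bigr => lab _.
  by rewrite /X; case: ifP; rewrite ?mulr0.
pose Y k l m w b : R := if #|porbits w| == k then if #|porbits b| == l then
  (m`!%:R^-1 : rat) *: (X k l w b *+ #|cycle_labels m (w * b)%g|) else 0 else 0.
transitivity ((d`!%:R^-1 : rat) *: \sum_(1 <= k < d.+1) \sum_(1 <= l < d.+1)
   \sum_(1 <= m < d.+1) \sum_(w : 'S_d) \sum_(b : 'S_d | transitive_on setT w b) Y k l m w b).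
  rewrite /connected_gf scaler_sumr; apply: eq_bigr => k _.
  rewrite scaler_sumr; apply: eq_bigr => l _; rewrite scaler_sumr; apply: eq_bigr => m _.
  rewrite inner scalerA mulrC -scalerA; congr (_ *: _).
  rewrite scaler_sumr; apply: eq_bigr => w _; rewrite scaler_sumr; apply: eq_bigr => b _.
  by rewrite /Y; do 2![case: ifP => _; rewrite ?scaler0 //].
congr (_ *: _).
under eq_bigr => k _ do under eq_bigr => l _ do rewrite exchange_big /=.
under eq_bigr => k _ do rewrite exchange_big /=.
rewrite exchange_big /=; apply: eq_bigr => w _.
under eq_bigr => k _ do under eq_bigr => l _ do rewrite exchange_big /=.
under eq_bigr => k _ do rewrite exchange_big /=.
rewrite exchange_big /=; apply: eq_bigr => b _.
transitivity (\sum_(1 <= k < d.+1) if #|porbits w| == k then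
    \sum_(1 <= l < d.+1) if #|porbits b| == l then
    \sum_(1 <= m < d.+1) if #|porbits (w * b)%g| == m then X k l w b else 0 else 0 else 0).
  apply: eq_bigr => k _; case: ifP => k_w; last first.
    by rewrite big1 // => l _; rewrite big1 // => m _; rewrite /Y k_w.
  apply: eq_bigr => l _; case: ifP => l_b; last first.
    by rewrite big1 // => m _; rewrite /Y k_w l_b.
  apply: eq_bigr => m _; rewrite /Y k_w l_b card_cycle_labels eq_sym.
  case: ifP => _; last by rewrite mulr0n scaler0.
  by rewrite -scaler_nat scalerA mulVf ?scale1r // pnatr_eq0 -lt0n fact_gt0.
rewrite !sum_nat_pred1 ?card_porbits_range //.
by rewrite /hypermap_weight /X /cycle_weight !prodr_const.
Qed.

End GeneratingFunction.

(** * From the recursions to the KP hierarchy *)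

Lemma hypermap_sum0 (R : comNzRingType) (p : nat -> R) (u v : R) :
  hypermap_sum p u v 0 = 1.
Proof.
have sum1 (F : 'S_0 -> R) : \sum_s F s = F 1%g.
  rewrite (eq_bigr (fun=> F 1%g)) => [|s _].
    by rewrite sumr_const card_Sn.
  by congr F; apply/permP => -[].
have weight1 (g : nat -> R) (s : 'S_0) : cycle_weight g s = 1.
  by apply: big1 => C /imsetP[[]].
by rewrite /hypermap_sum !sum1 /hypermap_weight !weight1 !mulr1.
Qed.

(** Both sides satisfy the same recursion, by [series_exp_rec] and [hypermap_sum_exp]; the binomial
    coefficients of the latter are absorbed by the factorials. *)
Lemma series_exp_connected (R : comAlgType rat) (p : nat -> R) (u v : R) (F : nat -> R) n :
    F 0%N = 0 ->
    (forall d, (0 < d)%N -> F d = (d`!%:R^-1 : rat) *: connected_sum p u v d) ->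
  series_exp F n = (n`!%:R^-1 : rat) *: hypermap_sum p u v n.
Proof.
move=> F0 F_conn; have [N] := ubnP n; elim: N => // N IHN in n *; rewrite ltnS => le_nN.
have [->|n_gt0] := posnP n.
  by rewrite /series_exp big_ord1 fact0 invr1 !scale1r hypermap_sum0.
have n_unit : (n%:R : rat) != 0 by rewrite pnatr_eq0 -lt0n.
apply: (@scalerI _ _ (n%:R : rat) n_unit); rewrite !scaler_nat -[LHS]mulr_natl.
rewrite series_exp_rec // scalerMnr hypermap_sum_exp scaler_sumr.
apply: eq_bigr => j _; have [j0|j_gt0] := posnP j.
  by rewrite j0 mul0n !mul0r mulr0n scaler0.
rewrite F_conn // IHN; last first.
  by rewrite (leq_trans _ le_nN) // ltn_subrL j_gt0.
have le_jn : (j <= n)%N by rewrite -ltnS.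
have bin_inv : (j`!%:R^-1 * (n - j)`!%:R^-1 : rat) = n`!%:R^-1 * 'C(n, j)%:R.
  rewrite -(bin_fact le_jn) !natrM invfM mulrAC mulVf ?mul1r ?invfM //.
  by rewrite pnatr_eq0 -lt0n bin_gt0.
rewrite -mulrA mulr_natl -scalerAl -scalerAr scalerA bin_inv.
by rewrite -scalerA scaler_nat scalerMnr -mulrnA mulnC.
Qed.

Lemma pder_pvar_one T i j :
  pder (@one_idx T) i (pvar (@one_idx T) j) = i%:R *+ (i == j).
Proof.
case: j => [|j]; first by rewrite pvar0 raddf0; case: eqP => [->|].
rewrite pvarS pderX; case: i => [|i]; first by rewrite mulr0n.
have -> : (one_idx T i.+1.-1 == one_idx T j) = (i.+1 == j.+1) by [].
by case: eqP => _; rewrite ?mulr1n ?mul0rn // mulr0n.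
Qed.

Lemma rmorph_polyC_params (R A : comNzRingType) (phi : {rmorphism R -> {poly A}})
    (a b : R) (a' b' : A) : phi a = a'%:P -> phi b = b'%:P ->
  phi (a * b *+ 4) = (a' * b' *+ 4)%:P /\ phi ((a + b) *+ 2) = ((a' + b') *+ 2)%:P.
Proof.
move=> phi_a phi_b.
by rewrite !rmorphMn !rmorphM !rmorphD /= phi_a phi_b.
Qed.

Lemma pder_param T t k : pder (@one_idx T) k (mvar (inl t : one_set T)) = 0.
Proof.
by rewrite pderX (_ : (_ == _) = false) ?mul0rn //.
Qed.

Lemma normalized_evolution (R : comAlgType rat) (E : R -> R) (h h' : R) n :
    E ((n`!%:R^-1 : rat)%:A * h) = (n`!%:R^-1 : rat)%:A * E h -> h' *+ 4 = E h ->
  ((n.+1`!%:R^-1 : rat) *: h') *+ (4 * n.+1) = E ((n`!%:R^-1 : rat) *: h).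
Proof.
rewrite !mulr_algl => -> <-; rewrite mulnC mulrnA -scalerMnr; congr (_ *+ 4).
rewrite -scaler_nat scalerA factS natrM invfM mulrA divff ?mul1r //.
by rewrite pnatr_eq0.
Qed.

Theorem corollary2 : KP_solution dessin_gf.
Proof.
pose p := pvar (@one_idx bool); pose d k : {additive _ -> _} := pder (@one_idx bool) k.
(* At 0, [p_var] is p_1 because of the predecessor, while [p] is 0; they agree here because all
   [mu i] are positive. *)
have gf_connected k : dessin_gf k = connected_gf p u_var v_var k.
  apply: eq_bigr => i _; apply: eq_bigr => j _.
  apply: eq_bigr => m _; apply: congr1; apply: eq_bigr => mu /andP[/forallP mu0 _].
  apply: congr1; apply: congr1; apply: eq_bigr => l _.
  by rewrite /p -(prednK (mu0 l)) pvarS.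
have gf0 : dessin_gf 0 = 0 by apply: big_geq.
have gfE n : series_exp dessin_gf n
    = (n`!%:R^-1 : rat) *: hypermap_sum p u_var v_var n.
  apply: series_exp_connected gf0 _ => k k0; rewrite gf_connected.
  exact: connected_gfE.
pose u2 : mpolyQ (two_sets bool) := mvar (inl false).
pose v2 : mpolyQ (two_sets bool) := mvar (inl true).
have msubst_uv (x : one_set bool -> {poly (mpolyQ (two_sets bool))}) :
    (forall t, x (inl t) = (mvar (inl t : two_sets bool))%:P) ->
    msubst x (u_var * v_var *+ 4) = (u2 * v2 *+ 4)%:P
    /\ msubst x ((u_var + v_var) *+ 2) = ((u2 + v2) *+ 2)%:P.
  move=> x_inl; have msubstE f : msubst x f = mcompose x f by rewrite mcompose.unlock.
  have x_u : mcompose x u_var = u2%:P by apply: etrans (mcomposeX x _) (x_inl _).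
  have x_v : mcompose x v_var = v2%:P by apply: etrans (mcomposeX x _) (x_inl _).
  have [x1 x2] := rmorph_polyC_params x_u x_v.
  by split; [exact: etrans (msubstE _) x1 | exact: etrans (msubstE _) x2].
have [minus1 minus2] := @msubst_uv (@minus_shift bool) (fun=> erefl).
have [plus1 plus2] := @msubst_uv (@plus_shift bool) (fun=> erefl).
apply: (KP_tau_evolution minus1 plus1 minus2 plus2) => [|n].
  by rewrite gfE hypermap_sum0 fact0 invr1 scale1r.
have d_param t k : d k (mvar (inl t : one_set bool)) = 0.
  exact: pder_param.
have d_const (q : rat) k : d k q%:A = 0.
  by rewrite -mul_malgC mulr1; apply: pderC.
have d_comm i j f : d i (d j f) = d j (d i f) by apply: pder_comm.
have d_bound f k : (var_bound (@one_rank bool) f <= k)%N -> d k f = 0.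
  exact: pder_bound.
have scaleE := @evolution_scale _ p d _ (pderM _) d_comm d_bound u_var v_var
  (n`!%:R^-1 : rat)%:A (hypermap_sum p u_var v_var n) (d_const _).
have evolE := hypermap_sum_evolution (pvar0 _) (pderM _) (@pder_pvar_one bool)
  d_comm d_bound n (d_param false) (d_param true).
by rewrite !gfE; apply: normalized_evolution scaleE evolE.
Qed.
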